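(* Suppose that for all integers $m_2\ge 2$ and $m_3\ge 1$ one has $$c^{m_2,m_3}_p>0\quad\text{for all integers } p \text{ with } 3\le p\le 2m_2-1,$$ where the numbers $c^{m_2,m_3}_p$ are defined in the context. Then for all $m_2,m_3\in\mathbb{N}$ and any centered Gaussian random vector $(X_1,X_2,X_3)$, $$E[X_1^{2}X_2^{2m_2}X_3^{2m_3}]\ge E[X_1^{2}]\,E[X_2^{2m_2}]\,E[X_3^{2m_3}],$$ and equality holds if and only if $X_1,X_2,X_3$ are independent.
   Context: $\mathbb{N}=\{1,2,3,\dots\}$. A centered Gaussian random vector is a jointly Gaussian vector with mean zero; its covariance matrix may be singular. Standing assumption: every Gaussian random variable is real-valued and non-zero, i.e. each component of a Gaussian random vector has strictly positive variance. For a nonnegative integer $k$, $\left(k+\frac12\right)\cdots\frac12$ denotes the product $\prod_{t=0}^{k}\left(t+\frac12\right)$ (factors decreasing by $1$ down to $\frac12$). For $m_2,m_3\in\mathbb{N}$ and an integer $0\le p\le 2m_2$, define $$\begin{aligned} c^{m_2,m_3}_p=&\sum_{i=\max(0,p-m_2)}^{\min(m_2,p)}\left[\frac{2^{2i}\left(m_3+i+\frac{1}{2}\right)\cdots\frac{1}{2}}{(2i)!\,(m_2-i)!}-\frac{\left(m_3-\frac{1}{2}\right)\cdots\frac{1}{2}}{2\,(i!)\,(m_2-i)!}\right]\\ &\quad\cdot\left[\frac{2^{2p-2i-1}(2m_2+2i-2p+1)\left(m_3+p-i-\frac{1}{2}\right)\cdots\frac{1}{2}}{(2p-2i)!\,(m_2+i-p)!}-\frac{\left(m_3-\frac{1}{2}\right)\cdots\frac{1}{2}}{2\,[(p-i)!]\,(m_2+i-p)!}\right]\\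 &-\sum_{i=\max(0,p-m_2)}^{\min(m_2,p)-1}\frac{2^{2p}\left[\left(m_3+i+\frac{1}{2}\right)\cdots\frac{1}{2}\right]\left[\left(m_3+p-i-\frac{1}{2}\right)\cdots\frac{1}{2}\right]}{(2i+1)!\,(2p-2i-1)!\,(m_2-i-1)!\,(m_2+i-p)!}, \end{aligned}$$ where an empty sum is $0$. *)

(* Defs.v *)
From mathcomp Require Import all_boot all_order all_algebra.
From mathcomp Require Import all_classical all_reals all_analysis.

Set Implicit Arguments.
Unset Strict Implicit.
Unset Printing Implicit Defensive.

Import Order.TTheory GRing.Theory Num.Theory.

Local Open Scope classical_set_scope.
Local Open Scope ring_scope.

(* (k + 1/2) (k - 1/2) ... (3/2) (1/2), with k + 1 factors *)
Definition half_prod (R : realType) (k : nat) : R :=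
  \prod_(t < k.+1) (t%:R + 2^-1).

(* All subtractions below are on nat and are exact in the range of summation
   (for m2, m3 >= 1 and p <= 2 m2), except for the lower bound p - m2, whose
   truncation gives max(0, p - m2).  The factor 2 ^ (2p - 2i - 1) is written
   2 ^+ (2 * (p - i)) / 2 because its exponent is -1 when i = p.
   Both upper bounds are exclusive, so that the sums end at min(m2, p) and
   min(m2, p) - 1 respectively. *)
Definition coef_c (R : realType) (m2 m3 p : nat) : R :=
  \sum_((p - m2)%N <= i < (minn m2 p).+1)
    ((2 ^+ (2 * i) * half_prod R (m3 + i)
        / ((2 * i)`!%:R * (m2 - i)`!%:R)
      - half_prod R (m3 - 1) / (2 * i`!%:R * (m2 - i)`!%:R))
     * (2 ^+ (2 * (p - i)) / 2 * (2 * (m2 + i - p) + 1)%N%:R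
          * half_prod R (m3 + (p - i) - 1)
          / ((2 * (p - i))`!%:R * (m2 + i - p)`!%:R)
        - half_prod R (m3 - 1) / (2 * (p - i)`!%:R * (m2 + i - p)`!%:R)))
  - \sum_((p - m2)%N <= i < minn m2 p)
      2 ^+ (2 * p) * (half_prod R (m3 + i) * half_prod R (m3 + (p - i) - 1))
      / ((2 * i + 1)`!%:R * (2 * (p - i) - 1)`!%:R
         * (m2 - i - 1)`!%:R * (m2 + i - p)`!%:R).

(* The normal law of mean m and standard deviation s >= 0, including the
   degenerate case s = 0, for which the library's normal_prob m 0 is not the
   point mass at m but, by convention, the uniform law on [0, 1]. *)
Definition gaussian_law (R : realType) (m s : R) (B : set R) : \bar R :=
  if s == 0 then \d_m B else normal_prob m s B.

Definition gaussian_RV d (T : measurableType d) (R : realType)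
    (P : probability T R) (Y : T -> R) : Prop :=
  exists m s : R, 0 <= s /\
    forall B : set R, measurable B -> P (Y @^-1` B) = gaussian_law m s B.

(* Joint Gaussianity: every linear combination of the components is Gaussian,
   possibly degenerate, so that singular covariance matrices are allowed. *)
Definition jointly_gaussian d (T : measurableType d) (R : realType)
    (P : probability T R) (n : nat) (X : n.-tuple {RV P >-> R}) : Prop :=
  forall a : 'I_n -> R, gaussian_RV P (fun w => \sum_(i < n) a i * tnth X i w).

Definition centered_gaussian_vector d (T : measurableType d) (R : realType)
    (P : probability T R) (n : nat) (X : n.-tuple {RV P >-> R}) : Prop :=
  [/\ jointly_gaussian X,
      forall i, ('E_P[tnth X i] = 0)%E &
      forall i, (0 < 'V_P[tnth X i])%E].

(* Mutual independence; product rules over subfamilies are the instances where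
   some of the B i are setT. *)
Definition independent_RVs d (T : measurableType d) (R : realType)
    (P : probability T R) (n : nat) (X : n.-tuple {RV P >-> R}) : Prop :=
  forall B : 'I_n -> set R, (forall i, measurable (B i)) ->
    P [set w | forall i, B i (tnth X i w)]
    = (\prod_(i < n) P (tnth X i @^-1` B i))%E.

(* Main.v *)
Require Import Defs.
From mathcomp Require Import all_boot all_order all_algebra.
From mathcomp Require Import all_classical all_reals all_analysis.
From mathcomp Require Import measurable_realfun ring lra zify.

Set Implicit Arguments.
Unset Strict Implicit.
Unset Printing Implicit Defensive.

Import Order.TTheory GRing.Theory Num.Theory.
Import numFieldNormedType.Exports.

Local Open Scope classical_set_scope.
Local Open Scope ring_scope.

(** Let q be the squared correlation of X2 and X3.  Then E[X2^2m X3^2n] is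
    E[X2^2m] E[X3^2n] F(q) for the hypergeometric polynomial
    F = 2F1(-m, -n; 1/2; .), and Gaussian integration by parts writes
    E[X1^2 X2^2m X3^2n] through F, F' and the covariances a, b of X1 with X2, X3.
    The claim becomes the positivity of a quadratic form in (a, b), constrained by
    the determinant of the covariance matrix being nonnegative.  Up to the factor
    1 - q the determinant of that form is
      Pi = (F-1)^2 + 2s F(F-1) + (1-q) (4mn F^2 - 4s q F F' - 4q(1-q) F'^2), s = m+n,
    and the hypergeometric equation gives
      (1-q) Pi' + (s+1) Pi = (s+1) ((F-1)^2 + 2s F(F-1) + 2(1-q)(F-1)F').
    At an interior minimum of Pi on [0, 1] the right-hand side is positive, so Pi > 0
    and the inequality is strict unless X1, X2, X3 are uncorrelated.  Independence then
    follows from Fourier uniqueness: Gaussian kernels are superpositions of cosines,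
    and half-lines are limits of their convolutions with such kernels. *)

(** * The hypergeometric polynomial and the discriminant *)

(** Joint Gaussianity supplies only the one-dimensional laws of linear combinations, and a singular
    covariance rules out a joint density. Joint moments are therefore read off as coefficients of
    polynomials in a real parameter, such as t -> E[(X2 + t X3)^(2N)], which a variance determines.
    Integration by parts becomes a comparison of coefficients, and after division by factorials the
    moment recursions are contiguous relations of F. The constraint enters through v1 (1-q) = kappa
    + a^2/v2 + b^2/v3 - 2abc/(v2 v3), where v_i = E[X_i^2], c = E[X2 X3] and kappa is the
    determinant of the covariance matrix over v2 v3. It trades the term v1 (F-1), over which a and b
    have no direct control, for a nonnegative remainder and a pure quadratic form. At q = 1 the
    factor 1 - q is lost, and collinearity of X2 and X3 is used instead. The identity for Pi is of
    first order because the hypergeometric equation removes F''; at a critical point it then yields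
    Pi itself. For independence, E[cos] comes from the moments by termwise integration, and products
    of cosines are sums of cosines of linear combinations. *)

Definition hcoef (R : realFieldType) (m n k : nat) : R :=
  4 ^+ k * (m ^_ k)%:R * (n ^_ k)%:R / (2 * k)`!%:R.
(* The terminating series 2F1(-m, -n; 1/2; q). *)
Definition hpoly (R : realFieldType) (m n : nat) : {poly R} :=
  \poly_(k < m.+1) hcoef R m n k.

Lemma coef_hpoly (R : realFieldType) m n k : (hpoly R m n)`_k = hcoef R m n k.
Proof.
rewrite coef_poly; case: ltnP => // mk.
by rewrite /hcoef ffact_small// mulr0 !mul0r.
Qed.

Lemma hcoef0 (R : realFieldType) m n : hcoef R m n 0 = 1.
Proof. by rewrite /hcoef !ffactn0 expr0 muln0 fact0 !mul1r invr1. Qed.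

Lemma hcoef_ge0 (R : realFieldType) m n k : 0 <= hcoef R m n k.
Proof. by rewrite /hcoef !mulr_ge0 ?invr_ge0 ?exprn_ge0 ?ler0n. Qed.

(** Works as a linear-combination tactic: a goal that follows from a known equation [c = d] is
    reduced to a ring identity once the multiplier [k] is supplied. *)
Lemma eq_by_sub (R : pzRingType) (k a b c d : R) :
  c = d -> a - b = k * (c - d) -> a = b.
Proof. by move=> -> /eqP; rewrite subrr mulr0 subr_eq0 => /eqP. Qed.

Lemma ffactSr (R : comPzRingType) m k :
  (m ^_ k.+1)%:R = (m ^_ k)%:R * (m%:R - k%:R) :> R.
Proof.
rewrite ffactnSr natrM; have [km|mk] := leqP k m; first by rewrite natrB.
by rewrite ffact_small// !mul0r.
Qed.
Lemma fact_doubleS (R : pzRingType) k :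
  (2 * k.+1)`!%:R = (2 * k%:R + 2) * (2 * k%:R + 1) * (2 * k)`!%:R :> R.
Proof.
rewrite mulnS (factS (2 * k).+1) (factS (2 * k)) mulnA natrM; congr (_ * _).
by rewrite natrM -[(2 * k).+2]addn2 -[(2 * k).+1]addn1 (natrD _ _ 2) (natrD _ _ 1) natrM.
Qed.

(** The term ratio of 2F1(-m, -n; 1/2; .). It fits the definition because (2k)! = 4^k k! (1/2)_k,
    with (1/2)_k a rising factorial, and the signs of (-m)_k and (-n)_k cancel. *)
Lemma hcoefS (R : realFieldType) m n k :
  (k%:R + 1) * (k%:R + 2^-1) * hcoef R m n k.+1 =
  (m%:R - k%:R) * (n%:R - k%:R) * hcoef R m n k.
Proof.
rewrite /hcoef !ffactSr exprS fact_doubleS.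
have : 0 < (2 * k)`!%:R :> R by rewrite ltr0n fact_gt0.
have : 0 <= k%:R :> R by rewrite ler0n.
move: (_`!%:R) (4 ^+ k) (m ^_ k)%:R (n ^_ k)%:R k%:R m%:R n%:R => u x1 x2 x3 x4 x5 x6 k0 u0.
by field; apply/and3P; split; rewrite lt0r_neq0//; lra.
Qed.

Lemma hcoefSl (R : realFieldType) m n k :
  (2 * k%:R + 1) * (k%:R + 1) * hcoef R m.+1 n k.+1 =
  2 * m.+1%:R * (n%:R - k%:R) * hcoef R m n k.
Proof.
have -> : hcoef R m.+1 n k.+1 = 4 * 4 ^+ k * (m.+1%:R * (m ^_ k)%:R) *
    ((n ^_ k)%:R * (n%:R - k%:R)) / (2 * k.+1)`!%:R.
  by rewrite /hcoef exprS (ffactSr R n) ffactSS natrM.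
rewrite /hcoef fact_doubleS.
have : 0 < (2 * k)`!%:R :> R by rewrite ltr0n fact_gt0.
have : 0 <= k%:R :> R by rewrite ler0n.
move: (_`!%:R) (4 ^+ k) (m ^_ k)%:R (n ^_ k)%:R k%:R m.+1%:R n%:R => u x1 x2 x3 x4 x5 x6 k0 u0.
by field; apply/and3P; split; rewrite lt0r_neq0//; lra.
Qed.

Lemma hcoefSS (R : realFieldType) m n k :
  (2 * k%:R + 1) * (k%:R + 1) * hcoef R m.+1 n.+1 k.+1 =
  2 * m.+1%:R * n.+1%:R * hcoef R m n k.
Proof.
have -> : hcoef R m.+1 n.+1 k.+1 = 4 * 4 ^+ k * (m.+1%:R * (m ^_ k)%:R) *
    (n.+1%:R * (n ^_ k)%:R) / (2 * k.+1)`!%:R.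
  by rewrite /hcoef exprS !ffactSS !natrM.
rewrite /hcoef fact_doubleS.
have : 0 < (2 * k)`!%:R :> R by rewrite ltr0n fact_gt0.
have : 0 <= k%:R :> R by rewrite ler0n.
move: (_`!%:R) (4 ^+ k) (m ^_ k)%:R (n ^_ k)%:R k%:R m.+1%:R n.+1%:R => u x1 x2 x3 x4 x5 x6 k0 u0.
by field; apply/and3P; split; rewrite lt0r_neq0//; lra.
Qed.

(** Gauss's equation with parameters -m, -n, 1/2; the coefficient of each power of [q] is an
    instance of [hcoefS]. *)
Lemma hpoly_ode (R : realFieldType) m n (q : R) (p := hpoly R m n) :
  q * (1 - q) * p^`()^`().[q] + (2^-1 + (m%:R + n%:R - 1) * q) * p^`().[q]
  = m%:R * n%:R * p.[q].
Proof.
suff /(congr1 (horner^~ q)) : p^`()^`() * 'X - p^`()^`() * 'X * 'X + 2^-1%:P * p^`() +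
    (m%:R + n%:R - 1)%:P * (p^`() * 'X) = (m%:R * n%:R)%:P * p.
  rewrite !(hornerD, hornerN, hornerMX, hornerCM) => <-; ring.
have pE k : p`_k = hcoef R m n k by exact: coef_hpoly.
apply/polyP => k; move: p pE => p pE.
have dE i : p^`()`_i = hcoef R m n i.+1 * (i%:R + 1).
  by rewrite coef_deriv pE natr1 mulr_natr.
have ddE i : p^`()^`()`_i = hcoef R m n i.+2 * (i%:R + 1 + 1) * (i%:R + 1).
  by rewrite coef_deriv dE -[LHS]mulr_natr -natr1.
rewrite !coefD coefN !coefCM !coefMX.
(* Multiplication by ['X] and ['X * 'X] shifts indices, so degrees 0 and 1 lose terms and are
   treated apart. *)
case: k => [|[|k]] /=; rewrite !(dE, ddE, pE).
- by apply: (eq_by_sub (k := 1) (hcoefS R m n 0)); ring.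
- by apply: (eq_by_sub (k := 1) (hcoefS R m n 1)); ring.
- by apply: (eq_by_sub (k := 1) (hcoefS R m n k.+2)); rewrite -!natr1; ring.
Qed.

Lemma hpolyC (R : realFieldType) m n : hpoly R m n = hpoly R n m.
Proof.
by apply/polyP => k; rewrite !coef_hpoly /hcoef -!mulrA [_ * (_ / _)]mulrCA.
Qed.

(** Rests on the falling-factorial identity behind [ffactnS]. The relation fixes the sign of 2nF -
    2qF' and is the recursion of the even moments in disguise. *)
Lemma hpolySr (R : realFieldType) m n :
  (n.+1)%:R%:P * hpoly R m n.+1 =
  (n.+1)%:R%:P * hpoly R m n + 'X * (hpoly R m n.+1)^`().
Proof.
apply/polyP => k; rewrite !(coefD, coefCM, coefXM, coef_deriv, coef_hpoly).
have -> : (if k == 0 then 0 else hcoef R m n.+1 k.-1.+1 *+ k.-1.+1) = hcoef R m n.+1 k * k%:R.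
  by case: k => [|k]; rewrite ?mulr0// mulr_natr.
have : (n.+1 ^_ k)%:R * (n.+1%:R - k%:R) = n.+1%:R * (n ^_ k)%:R :> R.
  by rewrite -ffactSr ffactnS /= natrM.
rewrite /hcoef; set x := (_ ^_ _)%:R; set y := (_ ^_ _)%:R; set z := (_ ^_ _)%:R; set w := _%:R^-1 => H.
by apply: (eq_by_sub (k := 4 ^+ k * z * w) H); ring.
Qed.

(** The shape is dictated by the recursion of the moments E[X2^(2m+1) X3^(2n+1)], which are
    multiples of the derivative with indices m+1, n+1. *)
Lemma deriv_hpolySS (R : realFieldType) m n :
  (2 * n%:R + 1)%:P * (hpoly R m.+1 n.+1)^`() =
  (2 * n.+1%:R)%:P * (hpoly R m.+1 n)^`() +
  (2 * m.+1%:R * n.+1%:R)%:P * hpoly R m n.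
Proof.
apply/polyP => k; rewrite !(coefD, coefCM, coef_deriv, coef_hpoly).
rewrite -[_ *+ _]mulr_natr -[hcoef _ _ n _ *+ _]mulr_natr -(natr1 k).
have k0 : (2 * k%:R + 1 : R) != 0 by have := ler0n R k; lra.
apply: (mulfI k0).
have := hcoefSl R m n k; have := hcoefSS R m n k; rewrite -(natr1 n).
move: (hcoef _ _ _ _) (hcoef _ _ _ _) (hcoef _ _ _ _) => x y z Hx Hy.
apply: (eq_by_sub (k := 2 * n%:R + 1) Hx); apply: (eq_by_sub (k := - 2 * (n%:R + 1)) Hy).
ring.
Qed.

Lemma horner_hpoly_ge1 (R : realFieldType) m n (q : R) : 0 <= q ->
  1 <= (hpoly R m n).[q].
Proof.
move=> q0; rewrite horner_poly big_ord_recl expr0 mulr1 hcoef0 lerDl.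
by apply: sumr_ge0 => i _; rewrite mulr_ge0 ?hcoef_ge0 ?exprn_ge0.
Qed.

Lemma horner_deriv_hpoly_ge0 (R : realFieldType) m n (q : R) : 0 <= q ->
  0 <= (hpoly R m n)^`().[q].
Proof.
move=> q0; rewrite horner_coef; apply: sumr_ge0 => i _.
by rewrite mulr_ge0 ?exprn_ge0// coef_deriv mulrn_wge0// coef_hpoly hcoef_ge0.
Qed.

Lemma horner_hpoly_gt1 (R : realFieldType) m n (q : R) : (0 < m)%N -> (0 < n)%N ->
  0 < q -> 1 < (hpoly R m n).[q].
Proof.
case: m n => [|m] [|n]// _ _ q0; rewrite horner_poly !big_ord_recl expr0 mulr1 hcoef0.
rewrite ltrDl ltr_pwDl//.
  by rewrite /hcoef /= !mulr_gt0 ?invr_gt0 ?exprn_gt0 ?ltr0n ?ffact_gt0.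
by apply: sumr_ge0 => i _; rewrite mulr_ge0 ?hcoef_ge0 ?exprn_ge0// ltW.
Qed.

Lemma horner_hpoly0 (R : realFieldType) m n : (hpoly R m n).[0] = 1.
Proof. by rewrite horner_coef0 coef_hpoly hcoef0. Qed.

Lemma hpoly_0r (R : realFieldType) m : hpoly R m 0 = 1.
Proof.
apply/polyP => k; rewrite coef_hpoly coef1.
by case: k => [|k]; rewrite ?hcoef0// /hcoef ffact0n mulr0 mul0r.
Qed.

Definition disc_poly (R : realFieldType) (m n : nat) : {poly R} :=
  let F := hpoly R m n in
  (F - 1) ^+ 2 + (2 * (m%:R + n%:R))%:P * (F * (F - 1))
  + (1 - 'X) * ((4 * m%:R * n%:R)%:P * F ^+ 2
      - (4 * (m%:R + n%:R))%:P * ('X * F * F^`())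
      - 4%:P * ('X * (1 - 'X) * F^`() ^+ 2)).

Lemma horner_disc_poly (R : realFieldType) m n (q : R) (F := (hpoly R m n).[q])
    (f := (hpoly R m n)^`().[q]) (s := m%:R + n%:R) :
  (disc_poly R m n).[q] = (F - 1) ^+ 2 + 2 * s * (F * (F - 1))
  + (1 - q) * (4 * m%:R * n%:R * F ^+ 2 - 4 * s * (q * F * f) - 4 * (q * (1 - q) * f ^+ 2)).
Proof. by rewrite /disc_poly !hornerE. Qed.

Lemma deriv_disc_poly (R : realFieldType) m n (q : R) (F := (hpoly R m n).[q])
    (f := (hpoly R m n)^`().[q]) (s := m%:R + n%:R) :
  (1 - q) * (disc_poly R m n)^`().[q] + (s + 1) * (disc_poly R m n).[q] =
  (s + 1) * ((F - 1) ^+ 2 + 2 * s * (F * (F - 1)) + 2 * (1 - q) * (F - 1) * f).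
Proof.
have := hpoly_ode m n q; rewrite horner_disc_poly /s /f /F /disc_poly.
move: (hpoly R m n) => p.
rewrite !poly.derivE !(hornerD, hornerN, hornerM, hornerX, hornerC, horner_exp).
set x := p.[q]; set y := p^`().[q]; set z := p^`()^`().[q] => H.
(* F'' enters Pi' only through q(1-q)F'', with factor -(4sF + 8(1-q)F'); this multiple of the
   differential equation removes it. *)
apply: (eq_by_sub (k := - (1 - q) * (4 * (m%:R + n%:R) * x + 8 * (1 - q) * y)) H).
by field; rewrite ?pnatr_eq0.
Qed.

Lemma disc_poly_gt0 (R : realType) m n (q : R) : (0 < m)%N -> (0 < n)%N ->
  0 <= q <= 1 -> 0 < (disc_poly R m n).[q].
Proof.
move=> m0 n0 /andP[q0 q1]; set p := disc_poly R m n.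
have [] := @EVT_min R (horner p) 0 1 ler01.
  by apply/continuous_subspaceT => x; exact: continuous_horner.
move=> c /[!in_itv]/= /andP[c0 c1] cmin.
suff pc : 0 < p.[c] by rewrite (lt_le_trans pc)// cmin// in_itv/= q0.
have M0 : 0 < m%:R :> R by rewrite ltr0n.
have N0 : 0 < n%:R :> R by rewrite ltr0n.
(* At 0 the value is 4mn since F(0) = 1; at 1 only the summands without the factor 1 - q survive,
   and F(1) > 1 makes them positive. *)
have [->|cn0] := eqVneq c 0.
  rewrite horner_disc_poly horner_hpoly0; have : 0 < m%:R * n%:R :> R by rewrite mulr_gt0.
  lra.
have {cn0} c0' : 0 < c by rewrite lt_neqAle eq_sym cn0.
have F1 : 0 < (hpoly R m n).[c] - 1 by rewrite subr_gt0 horner_hpoly_gt1.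
have f0 : 0 <= (hpoly R m n)^`().[c] by rewrite horner_deriv_hpoly_ge0.
have pos : 0 < ((hpoly R m n).[c] - 1) ^+ 2
    + 2 * (m%:R + n%:R) * ((hpoly R m n).[c] * ((hpoly R m n).[c] - 1)).
  apply: addr_gt0; first exact: exprn_gt0.
  by apply: mulr_gt0; apply: mulr_gt0 => //; [exact: addr_gt0|lra].
have [c1e|cn1] := eqVneq c 1.
  have e : 1 - c = 0 by rewrite c1e subrr.
  by rewrite horner_disc_poly e mul0r addr0.
have {cn1} c1' : c < 1 by rewrite lt_neqAle cn1.
have : is_derive c 1 (horner p) 0.
  apply: (@derive1_at_min _ (horner p) 0 1 c ler01).
  - by move=> t _; exact: derivable_horner.
  - by rewrite in_itv/= c0' c1'.
  - move=> t; rewrite in_itv/= => /andP[t0 t1]; apply: cmin.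
    by rewrite in_itv/= !ltW.
move=> [_]; rewrite -derive1E -derivE => p'0.
have := deriv_disc_poly m n c; rewrite /= p'0 mulr0 add0r => /mulfI -> //.
  apply: (ltr_wpDr _ pos); apply: (mulr_ge0 _ f0).
  by apply: (mulr_ge0 _ (ltW F1)); lra.
Qed.

(** Meant for al = a^2/v2, be = b^2/v3, ga = abc/(v2 v3), which makes a quadratic form in (a, b)
    linear. The difference of squares [key] shows that the diagonal dominates the cross term. *)
Lemma quadratic_form_ge0 (R : realFieldType) (al be ga q P Q C : R) :
  0 <= al -> 0 <= be -> 0 < P -> 0 < Q -> al * be * q = ga ^+ 2 ->
  0 < P * Q - q * C ^+ 2 ->
  0 <= al * P + be * Q + 2 * ga * C /\
  (al * P + be * Q + 2 * ga * C = 0 -> al = 0 /\ be = 0).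
Proof.
move=> al0 be0 P0 Q0 abq D0.
have key : (al * P + be * Q) ^+ 2 - (2 * ga * C) ^+ 2 =
    (al * P - be * Q) ^+ 2 + 4 * (al * be) * (P * Q - q * C ^+ 2).
  by apply: (eq_by_sub (k := 4 * C ^+ 2) abq); ring.
have ab0 : 0 <= 4 * (al * be) * (P * Q - q * C ^+ 2).
  by apply: mulr_ge0 (ltW D0); rewrite mulr_ge0// mulr_ge0.
have S0 : 0 <= al * P + be * Q by rewrite addr_ge0// mulr_ge0// ltW.
split.
  suff : `|2 * ga * C| <= al * P + be * Q by rewrite ler_norml => /andP[]; lra.
  rewrite -[leRHS]ger0_norm// -(ler_pXn2r (n := 2)) ?nnegrE// !real_normK ?num_real//.
  rewrite -subr_ge0 key; apply: addr_ge0 => //; exact: sqr_ge0.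
(* At a zero both nonnegative summands in [key] vanish: al P = be Q and al be = 0. *)
move=> e; move: key; have -> : 2 * ga * C = - (al * P + be * Q) by lra.
rewrite sqrrN subrr => /esym/eqP; rewrite paddr_eq0 ?sqr_ge0// => /andP[].
rewrite sqrf_eq0 subr_eq0 => /eqP aPbQ; rewrite mulf_eq0 (gt_eqF D0) orbF.
rewrite mulf_eq0 pnatr_eq0/= mulf_eq0 => /orP[]/eqP z; move: aPbQ; rewrite z mul0r.
  by move=> /esym/eqP; rewrite mulf_eq0 (gt_eqF Q0) orbF => /eqP.
by move=> /eqP; rewrite mulf_eq0 (gt_eqF P0) orbF => /eqP.
Qed.

(** By [hpolySr] the difference is 2n times the value of the same polynomial with [n] lowered by
    one. *)
Lemma horner_hpoly_deriv_lt (R : realFieldType) m n (q : R) : (0 < n)%N -> 0 <= q ->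
  0 < 2 * n%:R * (hpoly R m n).[q] - 2 * q * (hpoly R m n)^`().[q].
Proof.
case: n => // n _ q0; have /(congr1 (horner^~ q)) := hpolySr R m n.
rewrite !(hornerD, hornerM, hornerX, hornerC) => e.
rewrite -!mulrA -mulrBr e addrK mulr_gt0// mulr_gt0//.
by rewrite (lt_le_trans ltr01)// horner_hpoly_ge1.
Qed.

(* For [q < 1], multiplying by [1 - q] turns the claim into the positivity of a
   quadratic form of determinant [(1 - q) * disc_poly]. *)
Lemma hpoly_quadratic_ineq (R : realType) m n (v q al be ga : R)
    (F := (hpoly R m n).[q]) (f := (hpoly R m n)^`().[q])
    (V := v * F + al * (2 * m%:R * F - 2 * q * f) +
          be * (2 * n%:R * F - 2 * q * f) + 4 * ga * f) :
  (0 < m)%N -> (0 < n)%N -> 0 < v -> 0 <= q <= 1 -> 0 <= al -> 0 <= be ->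
  al * be * q = ga ^+ 2 -> 0 <= v * (1 - q) - al - be + 2 * ga ->
  (q = 1 -> be = al /\ ga = al) ->
  v <= V /\ (V = v -> [/\ al = 0, be = 0 & q = 0]).
Proof.
move=> m0 n0 v0 q01 al0 be0 abq kap qe1; case/andP: (q01) => q0 q1.
have F0 : 1 <= F by exact: horner_hpoly_ge1.
have B0 : 0 < 2 * n%:R * F - 2 * q * f by exact: horner_hpoly_deriv_lt.
have A0 : 0 < 2 * m%:R * F - 2 * q * f.
  by rewrite /F /f hpolyC; exact: horner_hpoly_deriv_lt.
have M0 : 0 < m%:R :> R by rewrite ltr0n.
have N0 : 0 < n%:R :> R by rewrite ltr0n.
have F1 : 0 < q -> 1 < F by exact: horner_hpoly_gt1.
(* The collinear case: [V] collapses to F (v + 2(m+n) al), which exceeds [v] because F(1) > 1. *)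
have [q1e|qn1] := eqVneq q 1.
  have [bea gaa] := qe1 q1e.
  have {}F1 : 1 < F by apply: F1; rewrite q1e.
  have : V = v * F + al * (2 * (m%:R + n%:R) * F).
    by rewrite /V bea gaa q1e; ring.
  have : 0 <= al * (2 * (m%:R + n%:R) * F).
    apply: (mulr_ge0 al0); apply: mulr_ge0; last exact: le_trans F0.
    by rewrite mulr_ge0// addr_ge0// ltW.
  have : v < v * F by rewrite ltr_pMr.
  by move=> h1 h2 ->; split; first lra; move=> h3; exfalso; lra.
have {qn1 q1} q1 : 0 < 1 - q by rewrite subr_gt0 lt_neqAle qn1.
set A := 2 * m%:R * F - 2 * q * f in A0 *; set B := 2 * n%:R * F - 2 * q * f in B0 *.
(* In (1-q)(V - v), replace v(1-q) by kappa + al + be - 2ga, with kappa the quantity assumed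
   nonnegative. Then [P], [Q] and [2 * C] collect the coefficients of [al], [be] and [ga]. *)
pose P := (F - 1) + (1 - q) * A; pose Q := (F - 1) + (1 - q) * B.
pose C := (1 - q) * (2 * f) - (F - 1).
have P0 : 0 < P by rewrite ltr_wpDl ?subr_ge0// mulr_gt0.
have Q0 : 0 < Q by rewrite ltr_wpDl ?subr_ge0// mulr_gt0.
have D0 : 0 < P * Q - q * C ^+ 2.
  suff -> : P * Q - q * C ^+ 2 = (1 - q) * (disc_poly R m n).[q].
    by rewrite mulr_gt0// disc_poly_gt0.
  by rewrite horner_disc_poly -/F -/f /P /Q /C /A /B; ring.
have [form0 form_eq0] := quadratic_form_ge0 al0 be0 P0 Q0 abq D0.
have VE : (1 - q) * (V - v) = (F - 1) * (v * (1 - q) - al - be + 2 * ga) +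
    (al * P + be * Q + 2 * ga * C).
  by rewrite /V -/A -/B /P /Q /C; ring.
have rest0 : 0 <= (F - 1) * (v * (1 - q) - al - be + 2 * ga).
  by rewrite mulr_ge0// subr_ge0.
split; first by rewrite -subr_ge0 -(pmulr_rge0 _ q1) VE addr_ge0.
move=> Vv; move/eqP: VE; rewrite Vv subrr mulr0 eq_sym paddr_eq0// => /andP[_ /eqP].
move=> /form_eq0[al_eq0 be_eq0]; split => //; apply/eqP.
have ga_eq0 : ga = 0.
  by apply/eqP; rewrite -sqrf_eq0 -abq al_eq0 !mul0r.
rewrite eq_le q0 andbT leNgt; apply/negP => /F1 {}F1.
by move: Vv; rewrite /V al_eq0 be_eq0 ga_eq0 => Vv; have := ltr_pMr v v0; nra.
Qed.

(** * The moment generating function of a normal law *)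

(** The Radon-Nikodym derivative of the law equals the density almost everywhere, because both
    integrate to the law over every measurable set. *)
Lemma ge0_integral_normal_prob (R : realType) (m s : R) (f : R -> \bar R) :
  measurable_fun [set: R] f -> (forall x, (0 <= f x)%E) ->
  (\int[normal_prob m s]_x f x =
   \int[lebesgue_measure]_x (f x * (normal_pdf m s x)%:E))%E.
Proof.
move=> mf f0; have dom := normal_prob_dominates m s.
rewrite -(Radon_Nikodym_SigmaFinite.change_of_variables dom)//.
have mpdf : measurable_fun [set: R] (EFin \o normal_pdf m s).
  by apply/measurable_EFinP; exact: measurable_normal_pdf.
have mRN : measurable_fun [set: R]
    (Radon_Nikodym_SigmaFinite.f (normal_prob m s) lebesgue_measure).
  exact: measurable_int (Radon_Nikodym_SigmaFinite.f_integrable dom).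
apply: ae_eq_integral => //; [exact: emeasurable_funM..|].
apply: ae_eqe_mul2l; apply: integral_ae_eq => //.
- exact: Radon_Nikodym_SigmaFinite.f_integrable.
- by move=> E _ mE; rewrite -Radon_Nikodym_SigmaFinite.f_integral.
Qed.

(* Completing the square: [expR (t x)] times the density of [N(m, s)] is a multiple of
   the density of [N(m + s ^+ 2 t, s)]. *)
Lemma normal_prob_mgf (R : realType) (m s t : R) : s != 0 ->
  (\int[normal_prob m s]_x (expR (t * x))%:E =
   (expR (m * t + s ^+ 2 * t ^+ 2 / 2))%:E)%E.
Proof.
move=> s0; rewrite ge0_integral_normal_prob//; last first.
  by apply/measurable_EFinP/measurableT_comp => //; exact: measurable_funM.
transitivity (\int[lebesgue_measure]_x
    ((expR (m * t + s ^+ 2 * t ^+ 2 / 2))%:E * (normal_pdf (m + s ^+ 2 * t) s x)%:E))%E.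
  apply: eq_integral => x _; rewrite -!EFinM !normal_pdfE//; congr EFin.
  rewrite mulrCA [RHS]mulrCA; congr (_ * _).
  rewrite /normal_fun -!expRD; congr expR.
  by field.
rewrite ge0_integralZl//.
- by rewrite integral_normal_pdf// mule1.
- by apply/measurable_EFinP; exact: measurable_normal_pdf.
- by move=> x _; rewrite lee_fin normal_pdf_ge0.
Qed.

(** Only preimages under [Y] are compared, so the same statement serves Dirac, normal and product
    laws. *)
Lemma ge0_integral_law d d' (T : measurableType d) (T' : measurableType d')
    (R : realType) (mu : {measure set T -> \bar R}) (nu : {measure set T' -> \bar R})
    (Y : T -> T') (g : T' -> \bar R) :
  measurable_fun [set: T] Y -> measurable_fun [set: T'] g -> (forall y, (0 <= g y)%E) ->
  (forall B, measurable B -> mu (Y @^-1` B) = nu B) ->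
  (\int[mu]_w g (Y w) = \int[nu]_y g y)%E.
Proof.
move=> mY mg g0 law; pose X : {mfun T >-> T'} := mfun_Sub (mem_set mY).
rewrite (eq_measure_integral (pushforward mu X)).
  by rewrite [RHS]ge0_integral_pushforward.
by move=> A mA _; rewrite -law.
Qed.

Lemma gaussian_RV_mgf d (T : measurableType d) (R : realType) (P : probability T R)
    (Y : T -> R) : measurable_fun [set: T] Y -> gaussian_RV P Y ->
  exists m s : R, forall t,
    (\int[P]_w (expR (t * Y w))%:E = (expR (m * t + s ^+ 2 * t ^+ 2 / 2))%:E)%E.
Proof.
move=> mY [m [s [s0 law]]]; exists m, s => t.
pose g (x : R) := (expR (t * x))%:E.
have mg : measurable_fun [set: R] g.
  by apply/measurable_EFinP/measurableT_comp => //; exact: measurable_funM.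
have g0 x : (0 <= g x)%E by rewrite lee_fin expR_ge0.
(* The degenerate law is a point mass at [m]; the formula with [s = 0] is its transform. *)
have [s_eq0|sn0] := eqVneq s 0.
  rewrite (@ge0_integral_law _ _ _ _ _ _ (\d_m) Y g mY mg g0).
    rewrite integral_dirac//= diracT mul1e /g s_eq0.
    by rewrite expr0n/= !mul0r addr0 mulrC.
  by move=> A mA; have := law A mA; rewrite /gaussian_law s_eq0 eqxx.
rewrite -normal_prob_mgf//.
apply: (@ge0_integral_law _ _ T (measurableTypeR R) _ _ (normal_prob m s) Y g) => //.
by move=> A mA; have := law A mA; rewrite /gaussian_law (negbTE sn0).
Qed.

(** * Exponential moments and differentiation under the integral *)

Definition exp_moments d (T : measurableType d) (R : realType) (P : probability T R)
    (Y : T -> R) : Prop :=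
  measurable_fun [set: T] Y /\
  forall t : R, P.-integrable [set: T] (fun w => (expR (t * Y w))%:E).

Lemma expr_norm_le_expR (R : realType) (x : R) k : `|x| ^+ k <= expR (k%:R * `|x|).
Proof.
rewrite expRM_natl; apply: lerXn2r; rewrite ?nnegrE ?expR_ge0//.
by rewrite (le_trans _ (expR_ge1Dx _))// lerDr.
Qed.

Lemma measurable_expR_mul d (T : measurableType d) (R : realType) (Y : T -> R) (t : R) :
  measurable_fun [set: T] Y -> measurable_fun [set: T] (fun w => expR (t * Y w)).
Proof. by move=> mY; apply: measurableT_comp => //; exact: measurable_funM. Qed.

Section exponential_moments.
Context d (T : measurableType d) (R : realType) (P : probability T R) (Y : T -> R).
Hypothesis eY : exp_moments P Y.

Let mY : measurable_fun [set: T] Y := eY.1.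

Lemma integrable_expR_norm (c : R) : 0 <= c ->
  P.-integrable [set: T] (fun w => (expR (c * `|Y w|))%:E).
Proof.
move=> c0; have := integrableD measurableT (eY.2 c) (eY.2 (- c)).
apply: le_integrable => //.
  apply/measurable_EFinP/measurable_expR_mul.
  exact: measurableT_comp.
move=> w _ /=; rewrite lee_fin [leLHS]ger0_norm ?expR_ge0//.
rewrite [leRHS]ger0_norm ?addr_ge0 ?expR_ge0//.
have [Y0|Y0] := ger0P (Y w); first by rewrite lerDl expR_ge0.
by rewrite mulrN -mulNr lerDr expR_ge0.
Qed.

Lemma expr_mul_expR_le (y t : R) k : `|y ^+ k * expR (t * y)| <= expR ((k%:R + `|t|) * `|y|).
Proof.
rewrite normrM normrX (ger0_norm (expR_ge0 _)) mulrDl expRD.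
rewrite ler_pM ?exprn_ge0 ?expR_ge0 ?expr_norm_le_expR// ler_expR.
by rewrite -normrM ler_norm.
Qed.

Lemma integrable_expr_expR k (t : R) :
  P.-integrable [set: T] (fun w => (Y w ^+ k * expR (t * Y w))%:E).
Proof.
have := integrable_expR_norm (addr_ge0 (ler0n R k) (normr_ge0 t)).
apply: le_integrable => //.
  apply/measurable_EFinP/measurable_funM; last exact: measurable_expR_mul.
  exact: measurable_funX.
by move=> w _ /=; rewrite lee_fin [leRHS]ger0_norm ?expR_ge0// expr_mul_expR_le.
Qed.

Lemma integrable_expr k : P.-integrable [set: T] (fun w => (Y w ^+ k)%:E).
Proof.
apply: eq_integrable (integrable_expr_expR k 0) => // w _.
by rewrite mul0r expR0 mulr1.
Qed.

Lemma is_derive_expR_moment k (t : R) :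
  is_derive t 1 (fun u => \int[P]_w (Y w ^+ k * expR (u * Y w)))
    (\int[P]_w (Y w ^+ k.+1 * expR (t * Y w))).
Proof.
pose f (u : R) w := Y w ^+ k * expR (u * Y w).
have df (u : R) (w : T) : is_derive u (1 : R) (f ^~ w) (Y w ^+ k.+1 * expR (u * Y w)).
  rewrite /f; apply: trigger_derive.
  by rewrite scaler0 add0r /GRing.scale/= exprSr mulr1 -mulrA [Y w * _]mulrC.
(* A common majorant of the derivatives for |u - t| < 1: there |u| is below |t| + 1, and |y|^(k+1)
   is at most exp((k+1)|y|). *)
pose G w := expR ((k.+1%:R + (`|t| + 1)) * `|Y w|).
have It : `]t - 1, t + 1[%classic t by rewrite /= in_itv/=; apply/andP; split; lra.
have intf u : `]t - 1, t + 1[%classic u -> P.-integrable [set: T] (EFin \o f u).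
  by move=> _; exact: integrable_expr_expR.
have derf u w : `]t - 1, t + 1[%classic u -> [set: T] w -> derivable (f ^~ w) u 1.
  by move=> _ _; have [] := df u w.
have G0 w : 0 <= G w by exact: expR_ge0.
have intG : P.-integrable [set: T] (EFin \o G).
  by apply: integrable_expR_norm; rewrite !addr_ge0.
have d1E u w : partial1of2 f u w = Y w ^+ k.+1 * expR (u * Y w).
  by rewrite partial1of2E; have [_ ->] := df u w.
have Gub u w : `]t - 1, t + 1[%classic u -> [set: T] w -> `|partial1of2 f u w| <= G w.
  rewrite /= in_itv/= => /andP[u1 u2] _; rewrite d1E (le_trans (expr_mul_expR_le _ _ _))//.
  rewrite /G ler_expR ler_wpM2r// lerD2l.
  have : `|u - t| <= 1 by rewrite ler_norml; lra.
  by have := ler_normD (u - t) t; rewrite subrK; lra.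
have dF := derivable_under_integral measurableT It intf derf G0 intG Gub.
have F' := differentiation_under_integral measurableT It intf derf G0 intG Gub.
apply: DeriveDef => //; rewrite -derive1E F'.
by apply: eq_Rintegral => w _; rewrite d1E.
Qed.

End exponential_moments.

Lemma Rintegral_expr0 d (T : measurableType d) (R : realType) (P : probability T R)
    (Y : T -> R) : \int[P]_w Y w ^+ 0 = 1.
Proof.
under eq_Rintegral do rewrite expr0.
by rewrite Rintegral_cst// mul1r [X in fine X](probability_setT P).
Qed.

(** The transform phi satisfies phi' = (m + s^2 t) phi. Differentiating k+1 times and setting t = 0
    gives the recursion, which is Gaussian integration by parts for powers. *)
Lemma mgf_moments d (T : measurableType d) (R : realType) (P : probability T R)
    (Y : T -> R) (m s : R) : measurable_fun [set: T] Y ->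
  (forall t, (\int[P]_w (expR (t * Y w))%:E = (expR (m * t + s ^+ 2 * t ^+ 2 / 2))%:E)%E) ->
  [/\ exp_moments P Y, \int[P]_w Y w = m &
      forall k, \int[P]_w Y w ^+ k.+2 =
        m * \int[P]_w Y w ^+ k.+1 + k.+1%:R * s ^+ 2 * \int[P]_w Y w ^+ k].
Proof.
move=> mY mgf.
have eY : exp_moments P Y.
  split=> // t; apply/integrableP; split.
    exact/measurable_EFinP/measurable_expR_mul.
  under eq_integral do rewrite gee0_abs ?lee_fin ?expR_ge0//.
  by rewrite mgf ltry.
pose phi k t := \int[P]_w (Y w ^+ k * expR (t * Y w)).
have dphi k t : is_derive t (1 : R) (phi k) (phi k.+1 t) by exact: is_derive_expR_moment.
have phi0E : phi 0%N = fun t => expR (m * t + s ^+ 2 * t ^+ 2 / 2).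
  apply/funext => t; rewrite /phi /Rintegral.
  by under eq_integral do rewrite expr0 mul1r; rewrite mgf.
have phi1E t : phi 1%N t = (m + s ^+ 2 * t) * phi 0%N t.
  have [_ <-] := dphi 0%N t; rewrite phi0E.
  have -> : (fun u => expR (m * u + s ^+ 2 * u ^+ 2 / 2)) =
      expR \o (fun u : R => m * u + s ^+ 2 * u ^+ 2 / 2) by [].
  apply: derive_val; apply: trigger_derive.
  by rewrite /GRing.scale/=; field.
have phiSS k t : phi k.+2 t = (m + s ^+ 2 * t) * phi k.+1 t + k.+1%:R * s ^+ 2 * phi k t.
  elim: k t => [|k IH] t.
    have [_ <-] := dphi 1%N t.
    have -> : phi 1%N = (fun u => (m + s ^+ 2 * u) * phi 0%N u) by apply/funext.
    apply: derive_val; apply: trigger_derive.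
    by rewrite /GRing.scale/= phi1E; ring.
  have [_ <-] := dphi k.+2 t.
  have -> : phi k.+2 = (fun u => (m + s ^+ 2 * u) * phi k.+1 u + k.+1%:R * s ^+ 2 * phi k u).
    by apply/funext => u; rewrite IH.
  apply: derive_val; apply: trigger_derive.
  by rewrite IH /GRing.scale/= -(natr1 k.+1); ring.
have phi_0 k : phi k 0 = \int[P]_w Y w ^+ k.
  by apply: eq_Rintegral => w _; rewrite mul0r expR0 mulr1.
split=> //.
  transitivity (phi 1%N 0); first by rewrite phi_0; apply: eq_Rintegral => w _; rewrite expr1.
  by rewrite phi1E phi0E !mulr0 expr0n/= mulr0 mul0r !addr0 expR0 mulr1.
by move=> k; rewrite -!phi_0 phiSS mulr0 addr0.
Qed.

Lemma centered_even_moments (R : realFieldType) (v : R) (M : nat -> R) :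
  M 0%N = 1 -> (forall k, M k.+2 = k.+1%:R * v * M k) ->
  forall N, M (2 * N)%N / (2 * N)`!%:R = v ^+ N / (2 ^+ N * N`!%:R).
Proof.
move=> M0 MSS; elim=> [|N IH]; first by rewrite muln0 M0 !expr0 fact0 !mul1r.
have E : (2 * N.+1)`!%:R = 2 * N.+1%:R * (2 * N).+1%:R * (2 * N)`!%:R :> R.
  have e2 : (2 * N).+2%:R = 2 * N.+1%:R :> R by rewrite -natrM mulnS.
  by rewrite mulnS (factS (2 * N).+1) (factS (2 * N)) mulnA natrM natrM e2.
rewrite E mulnS MSS factS exprS exprS natrM.
have n0 k : 0 < k.+1%:R :> R by rewrite ltr0n.
have f0 k : 0 < k`!%:R :> R by rewrite ltr0n fact_gt0.
move: IH (n0 (2 * N)%N) (n0 N) (f0 (2 * N)%N) (f0 N).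
have : 0 < 2 ^+ N :> R by rewrite exprn_gt0.
move: (M _) (2 * N).+1%:R (N.+1)%:R (2 * N)`!%:R N`!%:R (v ^+ N) (2 ^+ N).
move=> x x1 x2 x4 x5 x6 x7 h7 IH h1 h2 h4 h5.
have -> : x = x6 / (x7 * x5) * x4 by rewrite -IH divfK ?lt0r_neq0.
by field; rewrite !lt0r_neq0.
Qed.

(** * Random variables with all moments *)

(** Stable under sums and products, whereas [exp_moments] is not stable under products; polynomials
    in [X1], [X2], [X3] are thus integrable. *)
Definition all_moments d (T : measurableType d) (R : realType) (P : probability T R)
    (f : T -> R) : Prop :=
  measurable_fun [set: T] f /\ forall k, P.-integrable [set: T] (fun w => (f w ^+ k)%:E).

Section all_moments.
Context d (T : measurableType d) (R : realType) (P : probability T R).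
Implicit Types f g : T -> R.

Lemma all_moments_integrable f : all_moments P f -> P.-integrable [set: T] (EFin \o f).
Proof.
by move=> [mf /(_ 1%N)]; apply: eq_integrable => // w _; rewrite expr1.
Qed.

Lemma exp_moments_all_moments f : exp_moments P f -> all_moments P f.
Proof. by move=> ef; split=> [|k]; [exact: ef.1|exact: integrable_expr]. Qed.

Lemma all_momentsM f g : all_moments P f -> all_moments P g ->
  all_moments P (fun w => f w * g w).
Proof.
move=> [mf If] [mg Ig]; split=> [|k]; first exact: measurable_funM.
(* |f^k g^k| is at most f^(2k) + g^(2k). *)
have := integrableD measurableT (If (k + k)%N) (Ig (k + k)%N).
apply: le_integrable => //.
  by apply/measurable_EFinP/measurable_funX/measurable_funM.
move=> w _ /=; rewrite lee_fin exprMn !exprD -!expr2.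
rewrite [leRHS]ger0_norm ?addr_ge0 ?sqr_ge0// normrM.
move: (f w ^+ k) (g w ^+ k) => a b; rewrite -(real_normK (num_real a)) -(real_normK (num_real b)).
have := sqr_ge0 (`|a| - `|b|); have := normr_ge0 a; have := normr_ge0 b; nra.
Qed.

Lemma all_moments_cst (c : R) : all_moments P (fun=> c).
Proof.
by split=> [|k]; [exact: measurable_cst|exact: finite_measure_integrable_cst].
Qed.

Lemma all_momentsX f k : all_moments P f -> all_moments P (fun w => f w ^+ k).
Proof.
move=> af; elim: k => [|k IH].
  by under eq_fun do rewrite expr0; exact: all_moments_cst.
by under eq_fun do rewrite exprS; exact: all_momentsM.
Qed.

Lemma Rintegral_sum n (F : 'I_n -> T -> R) :
  (forall i, P.-integrable [set: T] (EFin \o F i)) ->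
  P.-integrable [set: T] (fun w => (\sum_(i < n) F i w)%:E) /\
  \int[P]_w (\sum_(i < n) F i w) = \sum_(i < n) \int[P]_w F i w.
Proof.
elim: n F => [|n IH] F IF.
  rewrite big_ord0; split.
    under eq_fun do rewrite big_ord0.
    exact: finite_measure_integrable_cst.
  under eq_Rintegral do rewrite big_ord0.
  by rewrite Rintegral_cst// mul0r.
have [I1 e1] := IH (fun i => F (widen_ord (leqnSn n) i)) (fun i => IF _).
split.
  under eq_fun do rewrite big_ord_recr/= EFinD.
  by apply: integrableD => //; exact: IF.
under eq_Rintegral do rewrite big_ord_recr/=.
by rewrite RintegralD// e1 big_ord_recr.
Qed.

Lemma all_momentsD f g : all_moments P f -> all_moments P g ->
  all_moments P (fun w => f w + g w).
Proof.
move=> af ag; split=> [|k]; first exact: measurable_funD af.1 ag.1.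
under eq_fun do rewrite exprDn.
apply: (Rintegral_sum _).1 => i.
apply: all_moments_integrable.
under eq_fun do rewrite -mulr_natr.
apply: all_momentsM; last exact: all_moments_cst.
by apply: all_momentsM; exact: all_momentsX.
Qed.

Lemma all_momentsZ (c : R) f : all_moments P f -> all_moments P (fun w => c * f w).
Proof. by move=> af; apply: all_momentsM => //; exact: all_moments_cst. Qed.

(* Dividing by the factorials turns the binomial formula into a Cauchy product. *)
Lemma Rintegral_binomial (W X Y : T -> R) (t : R) N :
  all_moments P W -> all_moments P X -> all_moments P Y ->
  \int[P]_w (W w * (X w + t * Y w) ^+ N) / N`!%:R =
  (\poly_(i < N.+1) (\int[P]_w (W w * (X w ^+ (N - i) * Y w ^+ i)) / ((N - i)`!%:R * i`!%:R))).[t].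
Proof.
move=> aW aX aY.
under eq_Rintegral do rewrite exprDn mulr_sumr.
rewrite (Rintegral_sum _).2; last first.
  move=> i; apply: all_moments_integrable; apply: all_momentsM => //.
  under eq_fun do rewrite -mulr_natr.
  apply: all_momentsM; last exact: all_moments_cst.
  by apply: all_momentsM; apply: all_momentsX => //; exact: all_momentsZ.
rewrite horner_poly mulr_suml; apply: eq_bigr => i _.
have iN : (i <= N)%N by rewrite -ltnS.
have -> : \int[P]_w (W w * (X w ^+ (N - i) * (t * Y w) ^+ i *+ 'C(N, i))) =
    ('C(N, i)%:R * t ^+ i) * \int[P]_w (W w * (X w ^+ (N - i) * Y w ^+ i)).
  rewrite -RintegralZl//; last first.
    apply: all_moments_integrable; apply: all_momentsM => //.
    by apply: all_momentsM; exact: all_momentsX.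
  apply: eq_Rintegral => w _; rewrite -mulr_natr exprMn; ring.
rewrite -(bin_fact iN) !natrM.
have : 0 < 'C(N, i)%:R :> R by rewrite ltr0n bin_gt0.
have : 0 < i`!%:R :> R by rewrite ltr0n fact_gt0.
have : 0 < (N - i)`!%:R :> R by rewrite ltr0n fact_gt0.
move: (\int[P]_w _) => I h1 h2 h3.
by field; rewrite !lt0r_neq0.
Qed.

End all_moments.

(** The evaluation points 0, 1, ... outnumber the degree of the difference. This turns identities in
    a real parameter into identities between joint moments. *)
Lemma poly_horner_inj (R : numFieldType) (p q : {poly R}) :
  (forall x, p.[x] = q.[x]) -> p = q.
Proof.
move=> pq; apply/eqP; rewrite -subr_eq0; apply/eqP.
apply: (@roots_geq_poly_eq0 _ _ [seq k%:R | k <- iota 0 (size (p - q))]).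
- by apply/allP => x _; rewrite /root hornerD hornerN pq subrr.
- by rewrite map_inj_uniq ?iota_uniq// => i j /eqP; rewrite eqr_nat => /eqP.
- by rewrite size_map size_iota.
Qed.

(** * Joint moments *)

(* For a centered Gaussian variable the two sides are both [v ^+ N (2N-1)!! / (2N)!],
   where [v] is the variance. *)
Definition gaussian_moments d (T : measurableType d) (R : realType) (P : probability T R)
    (Y : T -> R) : Prop :=
  forall N, \int[P]_w Y w ^+ (2 * N) / (2 * N)`!%:R =
    (\int[P]_w Y w ^+ 2) ^+ N / (2 ^+ N * N`!%:R).

(** Twice this coefficient is the second derivative at 0, which depends only on the values of the
    quadratic and its first two derivatives there. *)
Lemma coef2_quadratic_exp (R : numFieldType) (q l v : R) M :
  ((q%:P + (2 * l)%:P * 'X + v%:P * 'X^2) ^+ M.+2)`_2 =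
  M.+2%:R * q ^+ M.+1 * v + 2 * M.+2%:R * M.+1%:R * q ^+ M * l ^+ 2.
Proof.
set g := _ + _.
have coef_g i : g`_i = if i == 0%N then q else if i == 1%N then 2 * l else
    if i == 2%N then v else 0.
  rewrite /g !coefD !coefCM coefC coefX coefXn.
  by case: i => [|[|[|i]]]/=; rewrite ?mulr0 ?mulr1 ?addr0 ?add0r.
have g0 : g.[0] = q by rewrite horner_coef0 coef_g.
have g1 : g^`().[0] = 2 * l by rewrite horner_coef0 coef_deriv coef_g.
have g2 : g^`()^`().[0] = v *+ 2 by rewrite horner_coef0 !coef_deriv coef_g.
clearbody g.
have e : (g ^+ M.+2)^`()^`().[0] = (g ^+ M.+2)`_2 *+ 2.
  by rewrite horner_coef0 !coef_deriv.
apply: (mulfI (x := 2)); first by rewrite pnatr_eq0.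
rewrite [LHS]mulr_natl -e deriv_exp derivMn derivM deriv_exp !(hornerMn, hornerD, hornerM, horner_exp) g0 g1 g2 /=. by ring.
Qed.

Lemma deriv_quadratic (R : comNzRingType) (q c v : R) :
  (q%:P + (2 * c)%:P * 'X + v%:P * 'X^2)^`() = 2%:P * (c%:P + v%:P * 'X).
Proof.
apply/polyP => i; rewrite coef_deriv !coefD !coefCM coefC coefX coefXn.
rewrite coefD coefCM coefC coefX.
by case: i => [|[|i]]/=; rewrite -[LHS]mulr_natl; ring.
Qed.

Section second_moment.
Context d (T : measurableType d) (R : realType) (P : probability T R).
Implicit Types X Y : T -> R.

Lemma Rintegral_sqr_lin X Y (t : R) : all_moments P X -> all_moments P Y ->
  \int[P]_w (Y w + t * X w) ^+ 2 =
  \int[P]_w Y w ^+ 2 + 2 * \int[P]_w (X w * Y w) * t + \int[P]_w X w ^+ 2 * t ^+ 2.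
Proof.
move=> aX aY.
have IXY := all_moments_integrable (all_momentsM aX aY).
have IX := aX.2 2%N; have IY := aY.2 2%N.
have IXY' := all_moments_integrable (all_momentsZ (2 * t) (all_momentsM aX aY)).
have IX' := all_moments_integrable (all_momentsZ (t ^+ 2) (all_momentsX 2 aX)).
transitivity (\int[P]_w (Y w ^+ 2 + 2 * t * (X w * Y w) + t ^+ 2 * X w ^+ 2)).
  by apply: eq_Rintegral => w _; ring.
have ID := all_moments_integrable (all_momentsD (all_momentsX 2 aY)
  (all_momentsZ (2 * t) (all_momentsM aX aY))).
by rewrite !RintegralD// !RintegralZl//; ring.
Qed.

(** Compares coefficients of t^2 in E[(Y + tX)^(2N+4)], known for every t from the variance of Y +
    tX. It is a case of Isserlis' formula, the factor (2N+2)(2N+1) being absorbed by the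
    factorials. *)
Lemma Rintegral_sqr_mul_even X Y N : all_moments P X -> all_moments P Y ->
  (forall t, gaussian_moments P (fun w => Y w + t * X w)) ->
  \int[P]_w (X w ^+ 2 * Y w ^+ (2 * N.+1)) / (2 * N.+1)`!%:R =
  \int[P]_w X w ^+ 2 * (\int[P]_w Y w ^+ (2 * N.+1) / (2 * N.+1)`!%:R) +
  (\int[P]_w (X w * Y w)) ^+ 2 * (\int[P]_w Y w ^+ (2 * N) / (2 * N)`!%:R).
Proof.
move=> aX aY gYX.
have gY : gaussian_moments P Y.
  have -> : Y = (fun w => Y w + 0 * X w) by apply/funext => w; rewrite mul0r addr0.
  exact: gYX.
set q := \int[P]_w Y w ^+ 2; set l := \int[P]_w (X w * Y w).
set v := \int[P]_w X w ^+ 2.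
have a1 : all_moments P (fun=> 1) by exact: all_moments_cst.
pose c : R := (2 ^+ N.+2 * N.+2`!%:R)^-1.
have : \poly_(i < (2 * N.+2).+1) (\int[P]_w (1 * (Y w ^+ (2 * N.+2 - i) * X w ^+ i)) /
      ((2 * N.+2 - i)`!%:R * i`!%:R)) =
    c%:P * (q%:P + (2 * l)%:P * 'X + v%:P * 'X^2) ^+ N.+2.
  apply: poly_horner_inj => t; rewrite -Rintegral_binomial//.
  under eq_Rintegral do rewrite mul1r.
  rewrite gYX Rintegral_sqr_lin// -/q -/v -/l.
  by rewrite hornerCM horner_exp !hornerD !hornerCM hornerC hornerX hornerXn [RHS]mulrC.
move=> /(congr1 (fun p : {poly R} => p`_2)).
rewrite coef_poly coefCM coef2_quadratic_exp (_ : (2 < _)%N = true); last by lia.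
have -> : (2 * N.+2 - 2 = 2 * N.+1)%N by rewrite mulnS addKn.
have -> : \int[P]_w (1 * (Y w ^+ (2 * N.+1) * X w ^+ 2)) =
    \int[P]_w (X w ^+ 2 * Y w ^+ (2 * N.+1)).
  by apply: eq_Rintegral => w _; rewrite mul1r mulrC.
move=> e; rewrite !gY -/q.
have -> : \int[P]_w (X w ^+ 2 * Y w ^+ (2 * N.+1)) / (2 * N.+1)`!%:R =
  2 * (\int[P]_w (X w ^+ 2 * Y w ^+ (2 * N.+1)) / ((2 * N.+1)`!%:R * 2`!%:R)).
  have : 0 < (2 * N.+1)`!%:R :> R by rewrite ltr0n fact_gt0.
  have -> : 2`!%:R = 2 :> R by [].
  by move: (_`!%:R) => u u0; field; rewrite lt0r_neq0.
rewrite e /c !factS !natrM !exprS.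
have : 0 < N`!%:R :> R by rewrite ltr0n fact_gt0.
have : 0 < N.+1%:R :> R by rewrite ltr0n.
have : 0 < N.+2%:R :> R by rewrite ltr0n.
have : 0 < 2 ^+ N :> R by rewrite exprn_gt0.
move: (2 ^+ N) N.+2%:R N.+1%:R N`!%:R (q ^+ N) => x1 x2 x3 x4 x5 h1 h2 h3 h4.
by field; rewrite !lt0r_neq0.
Qed.

End second_moment.

Section joint_moments.
Context d (T : measurableType d) (R : realType) (P : probability T R).
Variables X1 X2 X3 : T -> R.
Hypotheses (a1 : all_moments P X1) (a2 : all_moments P X2) (a3 : all_moments P X3).
Hypothesis gX : forall s t, gaussian_moments P (fun w => X2 w + t * X3 w + s * X1 w).

Let v1 := \int[P]_w X1 w ^+ 2.
Let v2 := \int[P]_w X2 w ^+ 2.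
Let v3 := \int[P]_w X3 w ^+ 2.
Let c := \int[P]_w (X2 w * X3 w).
Let a := \int[P]_w (X1 w * X2 w).
Let b := \int[P]_w (X1 w * X3 w).

(* Under this exponential normalization the moment recursions carry no binomials. *)
Definition norm_moment j k : R :=
  \int[P]_w (X2 w ^+ j * X3 w ^+ k) / (j`!%:R * k`!%:R).

Let aU t : all_moments P (fun w => X2 w + t * X3 w).
Proof. by apply: all_momentsD => //; exact: all_momentsZ. Qed.

Let gU t : gaussian_moments P (fun w => X2 w + t * X3 w).
Proof.
have -> : (fun w => X2 w + t * X3 w) = (fun w => X2 w + t * X3 w + 0 * X1 w).
  by apply/funext => w; rewrite mul0r addr0.
exact: gX.
Qed.

Let norm_moment_poly N t :
  \int[P]_w (X2 w + t * X3 w) ^+ N / N`!%:R =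
  (\poly_(i < N.+1) norm_moment (N - i) i).[t].
Proof.
have := Rintegral_binomial t N (all_moments_cst P 1) a2 a3.
under eq_Rintegral do rewrite mul1r.
move=> ->; congr (_.[t]); apply/polyP => i; rewrite !coef_poly; case: ifP => // _.
by rewrite /norm_moment; under eq_Rintegral do rewrite mul1r.
Qed.

(** [Rintegral_sqr_mul_even] for [X1] and U = X2 + t X3, where E[X1 U] = a + bt. The terms form the
    coefficient of t^(2n+2), the square (a + bt)^2 producing the index shifts. *)
Lemma norm_moment_sqr m n :
  \int[P]_w (X1 w ^+ 2 * (X2 w ^+ (2 * m.+1) * X3 w ^+ (2 * n.+1))) /
    ((2 * m.+1)`!%:R * (2 * n.+1)`!%:R) =
  v1 * norm_moment (2 * m.+1) (2 * n.+1) + a ^+ 2 * norm_moment (2 * m) (2 * n.+1) +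
  2 * a * b * norm_moment (2 * m).+1 (2 * n).+1 + b ^+ 2 * norm_moment (2 * m.+1) (2 * n).
Proof.
pose N := (m + n).+1.
have aX1 := all_momentsX 2 a1.
have : \poly_(i < (2 * N.+1).+1) (\int[P]_w (X1 w ^+ 2 * (X2 w ^+ (2 * N.+1 - i) * X3 w ^+ i)) /
      ((2 * N.+1 - i)`!%:R * i`!%:R)) =
    v1%:P * \poly_(i < (2 * N.+1).+1) norm_moment (2 * N.+1 - i) i +
    (a%:P + b%:P * 'X) ^+ 2 * \poly_(i < (2 * N).+1) norm_moment (2 * N - i) i.
  apply: poly_horner_inj => t; rewrite -Rintegral_binomial//.
  rewrite (Rintegral_sqr_mul_even N a1 (aU t) (fun s => gX s t)).
  rewrite !norm_moment_poly hornerD [in RHS]hornerM hornerC -/v1; congr (_ + _).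
  rewrite hornerM horner_exp hornerD hornerC hornerM hornerC hornerX.
  congr (_ ^+ 2 * _).
  have I1 := all_moments_integrable (all_momentsM a1 a2).
  have I2 := all_moments_integrable (all_momentsM a1 a3).
  have I3 := all_moments_integrable (all_momentsZ t (all_momentsM a1 a3)).
  transitivity (\int[P]_w (X1 w * X2 w + t * (X1 w * X3 w))).
    by apply: eq_Rintegral => w _; ring.
  by rewrite RintegralD// RintegralZl// mulrC.
move=> /(congr1 (fun p : {poly R} => p`_(2 * n).+2)).
set p := \poly_(i < (2 * N).+1) _.
have -> : (v1%:P * \poly_(i < (2 * N.+1).+1) norm_moment (2 * N.+1 - i) i +
    (a%:P + b%:P * 'X) ^+ 2 * p) = v1%:P * \poly_(i < (2 * N.+1).+1) norm_moment (2 * N.+1 - i) i +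
   ((a ^+ 2)%:P * p + (2 * a * b)%:P * (p * 'X) + (b ^+ 2)%:P * (p * 'X * 'X)) by ring.
rewrite !(coefD, coefCM, coefMX) /= /p !coef_poly.
rewrite (_ : ((2 * n).+2 < (2 * N.+1).+1)%N = true); last by rewrite /N; lia.
rewrite (_ : ((2 * n).+2 < (2 * N).+1)%N = true); last by rewrite /N; lia.
rewrite (_ : ((2 * n).+1 < (2 * N).+1)%N = true); last by rewrite /N; lia.
rewrite (_ : (2 * n < (2 * N).+1)%N = true); last by rewrite /N; lia.
have -> : (2 * N.+1 - (2 * n).+2 = 2 * m.+1)%N by rewrite /N; lia.
have -> : (2 * N - (2 * n).+2 = 2 * m)%N by rewrite /N; lia.
have -> : (2 * N - (2 * n).+1 = (2 * m).+1)%N by rewrite /N; lia.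
have -> : (2 * N - (2 * n) = 2 * m.+1)%N by rewrite /N; lia.
have -> : ((2 * n).+2 = 2 * n.+1)%N by lia.
by move=> ->; rewrite !addrA.
Qed.

Let norm_moment_gen N : \poly_(i < (2 * N).+1) norm_moment (2 * N - i) i =
  (2 ^+ N * N`!%:R)^-1%:P * (v2%:P + (2 * c)%:P * 'X + v3%:P * 'X^2) ^+ N.
Proof.
have cE : \int[P]_w (X3 w * X2 w) = c by apply: eq_Rintegral => w _; rewrite mulrC.
apply: poly_horner_inj => t; rewrite -norm_moment_poly gU Rintegral_sqr_lin// cE.
by rewrite hornerCM horner_exp !hornerD !hornerCM hornerC hornerX hornerXn [RHS]mulrC.
Qed.

(** With Q = v2 + 2ct + v3 t^2, the derivative of Q^(N+1)/(2^(N+1) (N+1)!) is (c + v3 t) Q^N/(2^N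
    N!); the coefficients of t^k are compared. The odd sum [j + k] gives the moment on the left an
    even total degree. *)
Lemma norm_momentS N j k : (j + k = (2 * N).+1)%N ->
  k.+1%:R * norm_moment j k.+1 =
  (if j is j'.+1 then c * norm_moment j' k else 0) +
  (if k is k'.+1 then v3 * norm_moment j k' else 0).
Proof.
move=> jk.
have : (\poly_(i < (2 * N.+1).+1) norm_moment (2 * N.+1 - i) i)^`() =
    c%:P * (\poly_(i < (2 * N).+1) norm_moment (2 * N - i) i) +
    v3%:P * ((\poly_(i < (2 * N).+1) norm_moment (2 * N - i) i) * 'X).
  rewrite !norm_moment_gen.
  rewrite derivM derivC mul0r add0r deriv_exp deriv_quadratic -[_ *+ N.+1]mulr_natl -polyC_natr factS natrM exprS.
  move: (_ ^+ N.+1.-1) => h.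
  have -> : (2 * 2 ^+ N * (N.+1%:R * N`!%:R))^-1 = 2^-1 * N.+1%:R^-1 * (2 ^+ N * N`!%:R)^-1 :> R.
    by rewrite -!invfM mulrACA.
  move: ((2 ^+ N * N`!%:R)^-1) => u.
  have e1 : (N.+1%:R^-1)%:P * N.+1%:R%:P = 1 :> {poly R}.
    by rewrite -polyCM mulVf// pnatr_eq0.
  have e2 : (2^-1)%:P * 2%:P = 1 :> {poly R}.
    by rewrite -polyCM mulVf// pnatr_eq0.
  rewrite !polyCM; move: e1 e2; move: (N.+1%:R^-1)%:P N.+1%:R%:P (2^-1)%:P 2%:P u%:P c%:P v3%:P.
  move=> y1 y2 y3 y4 y5 y6 y7 e1 e2.
  transitivity ((y3 * y4) * (y1 * y2) * (y5 * h * (y6 + y7 * 'X))); first by ring.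
  by rewrite e1 e2; ring.
move=> /(congr1 (fun p : {poly R} => p`_k)).
rewrite coef_deriv coefD !coefCM coefMX !coef_poly -[_ *+ _]mulr_natl.
rewrite (_ : (k.+1 < (2 * N.+1).+1)%N = true); last by lia.
have -> : (2 * N.+1 - k.+1 = j)%N by lia.
(* For [j = 0] an index exceeds the degree 2N; for [k = 0] multiplication by ['X] leaves no constant
   term. Both at once would contradict parity. *)
move=> ->; case: j jk => [|j] jk; case: k jk => [|k] jk.
- by lia.
- rewrite /= (_ : (k.+1 < (2 * N).+1)%N = false); last by lia.
  rewrite (_ : (k < (2 * N).+1)%N = true); last by lia.
  have -> : (2 * N - k = 0)%N by lia.
  by rewrite mulr0.
- rewrite /= mulr0.
  have -> : (2 * N - 0 = j)%N by lia.
  by [].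
- rewrite /= (_ : (k.+1 < (2 * N).+1)%N = true); last by lia.
  rewrite (_ : (k < (2 * N).+1)%N = true); last by lia.
  have -> : (2 * N - k = j.+1)%N by lia.
  have -> : (2 * N - k.+1 = j)%N by lia.
  by [].
Qed.

(** Induction on [n], for all [m] and both parities at once: odd moments at n need the even ones at
    n and the odd ones at n-1, even moments at n+1 need both kinds at n. [norm_momentS] then becomes
    [deriv_hpolySS] and [hpolySr] respectively. *)
Lemma norm_moment_hpoly (q := c ^+ 2 / (v2 * v3)) : 0 < v2 -> 0 < v3 -> forall m n,
  norm_moment (2 * m) (2 * n) = v2 ^+ m * v3 ^+ n / (2 ^+ (m + n) * m`!%:R * n`!%:R) *
    (hpoly R m n).[q] /\
  norm_moment (2 * m).+1 (2 * n).+1 = 2 * v2 ^+ m * v3 ^+ n * c /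
     (2 ^+ (m.+1 + n.+1) * m.+1`!%:R * n.+1`!%:R) * (hpoly R m.+1 n.+1)^`().[q].
Proof.
move=> v2_gt0 v3_gt0.
have n0 k : 0 < k.+1%:R :> R by rewrite ltr0n.
have f0 k : 0 < k`!%:R :> R by rewrite ltr0n fact_gt0.
have p0 k : 0 < 2 ^+ k :> R by rewrite exprn_gt0.
have g2 : gaussian_moments P X2.
  have -> : X2 = (fun w => X2 w + 0 * X3 w) by apply/funext => w; rewrite mul0r addr0.
  exact: gU.
have base m : norm_moment (2 * m) 0 = v2 ^+ m / (2 ^+ m * m`!%:R).
  rewrite -g2 /norm_moment fact0 mulr1; congr (_ / _).
  by apply: eq_Rintegral => w _; rewrite expr0 mulr1.
pose evenP m n := norm_moment (2 * m) (2 * n) =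
  v2 ^+ m * v3 ^+ n / (2 ^+ (m + n) * m`!%:R * n`!%:R) * (hpoly R m n).[q].
pose oddP m n := norm_moment (2 * m).+1 (2 * n).+1 = 2 * v2 ^+ m * v3 ^+ n * c /
     (2 ^+ (m.+1 + n.+1) * m.+1`!%:R * n.+1`!%:R) * (hpoly R m.+1 n.+1)^`().[q].
have odd_step n : (forall m, evenP m n) ->
    (if n is n'.+1 then forall m, oddP m n' else True) -> forall m, oddP m n.
  move=> IHe IHo m; rewrite /oddP.
  have /(congr1 (horner^~ q)) := deriv_hpolySS R m n.
  rewrite hornerD !hornerCM => Hf.
  have e1 : 2 * n%:R + 1 = (2 * n).+1%:R :> R by rewrite -[RHS]natr1 natrM.
  have hS : ((2 * m).+1 + 2 * n = (2 * (m + n)).+1)%N by lia.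
  apply: (mulfI (lt0r_neq0 (n0 (2 * n)%N))); rewrite (norm_momentS hS).
  rewrite IHe [RHS]mulrCA -e1 Hf !exprD !exprS !factS !natrM.
  have := n0 n; have := n0 m; have := f0 n; have := f0 m; have := p0 m; have := p0 n.
  case: n IHo {IHe Hf e1 hS} => [|n] IHo.
    rewrite /= addr0 !expr0 fact0 !hpoly_0r derivC !hornerC mulr0 add0r.
    move: (v2 ^+ m) (2 ^+ m) m.+1%:R m`!%:R => x1 x2 x3 x4 _ h2 h3 _ h4 _.
    by field; rewrite !lt0r_neq0.
  have -> : (2 * n.+1 = (2 * n).+2)%N by lia.
  rewrite IHo !exprD !exprS !factS !natrM.
  have := n0 n; have := f0 n; have := p0 n.
  move: (v2 ^+ m) (2 ^+ m) m.+1%:R m`!%:R (v3 ^+ n) (2 ^+ n) n.+2%:R n.+1%:R n`!%:R.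
  move=> x1 x2 x3 x4 x5 x6 x7 x8 x9 h1 h2 h3 _ h4 h5 _ h7 h8.
  by field; rewrite !lt0r_neq0.
have even_step n : (forall m, evenP m n) -> (forall m, oddP m n) -> forall m, evenP m n.+1.
  move=> IHe IHo m; rewrite /evenP.
  have /(congr1 (horner^~ q)) := hpolySr R m n.
  rewrite hornerD !hornerM !hornerC hornerX => HF.
  have hS : (2 * m + (2 * n).+1 = (2 * (m + n)).+1)%N by lia.
  have e1 : (2 * n).+2%:R = 2 * n.+1%:R :> R by rewrite -natrM; congr _%:R; lia.
  apply: (mulfI (lt0r_neq0 (n0 (2 * n).+1))).
  rewrite (_ : (2 * n.+1 = (2 * n).+2)%N); last by lia.
  rewrite (norm_momentS hS) IHe e1 -[RHS]mulrA [X in _ = 2 * X]mulrCA HF.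
  rewrite !exprD !exprS !factS !natrM.
  have := n0 n; have := f0 n; have := p0 n.
  case: m {hS HF} => [|m].
    rewrite muln0 hpolyC hpoly_0r hornerC hpolyC hpoly_0r derivC hornerC !expr0 fact0 mulr0 addr0 add0r.
    move: (v3 ^+ n) (2 ^+ n) n.+1%:R n`!%:R => x1 x2 x3 x4 h2 h3 h4.
    by field; rewrite !lt0r_neq0.
  have -> : (2 * m.+1 = (2 * m).+2)%N by lia.
  rewrite IHo /q !exprD !exprS !factS !natrM.
  have := n0 m; have := f0 m; have := p0 m.
  set F := _.[_]; set f := _.[_].
  move: (v2 ^+ m) (2 ^+ m) m.+1%:R m`!%:R (v3 ^+ n) (2 ^+ n) n.+1%:R n`!%:R F f.
  move=> x1 x2 x3 x4 x5 x6 x7 x8 F f h1 h2 h3 h4 h5 h6.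
  by field; rewrite !lt0r_neq0.
suff main n : (forall m, evenP m n) /\ (forall m, oddP m n) by
  move=> m n; have [He Ho] := main n; split; [exact: He|exact: Ho].
elim: n => [|n [He Ho]].
  have He m : evenP m 0%N.
    by rewrite /evenP muln0 base hpoly_0r hornerC addn0 expr0 fact0 !mulr1.
  by split=> //; exact: odd_step.
have He' := even_step n He Ho.
by split=> //; exact: odd_step.
Qed.

End joint_moments.

(** * The moment inequality *)

Section moment_inequality.
Context d (T : measurableType d) (R : realType) (P : probability T R).
Variables X1 X2 X3 : T -> R.
Hypotheses (a1 : all_moments P X1) (a2 : all_moments P X2) (a3 : all_moments P X3).
Hypothesis gX : forall s t, gaussian_moments P (fun w => X2 w + t * X3 w + s * X1 w).

Let v1 := \int[P]_w X1 w ^+ 2.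
Let v2 := \int[P]_w X2 w ^+ 2.
Let v3 := \int[P]_w X3 w ^+ 2.
Let c := \int[P]_w (X2 w * X3 w).
Let a := \int[P]_w (X1 w * X2 w).
Let b := \int[P]_w (X1 w * X3 w).

Hypotheses (v1_gt0 : 0 < v1) (v2_gt0 : 0 < v2) (v3_gt0 : 0 < v3).

Lemma Rintegral_sqr_comb x y z : \int[P]_w (x * X1 w + y * X2 w + z * X3 w) ^+ 2 =
  x ^+ 2 * v1 + y ^+ 2 * v2 + z ^+ 2 * v3 + 2 * x * y * a + 2 * x * z * b + 2 * y * z * c.
Proof.
transitivity (\int[P]_w (x ^+ 2 * X1 w ^+ 2 + y ^+ 2 * X2 w ^+ 2 + z ^+ 2 * X3 w ^+ 2
    + 2 * x * y * (X1 w * X2 w) + 2 * x * z * (X1 w * X3 w) + 2 * y * z * (X2 w * X3 w))).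
  by apply: eq_Rintegral => w _; ring.
have I11 := all_momentsZ (x ^+ 2) (all_momentsX 2 a1).
have I22 := all_momentsZ (y ^+ 2) (all_momentsX 2 a2).
have I33 := all_momentsZ (z ^+ 2) (all_momentsX 2 a3).
have I12 := all_momentsZ (2 * x * y) (all_momentsM a1 a2).
have I13 := all_momentsZ (2 * x * z) (all_momentsM a1 a3).
have I23 := all_momentsZ (2 * y * z) (all_momentsM a2 a3).
have S2 := all_momentsD I11 I22; have S3 := all_momentsD S2 I33.
have S4 := all_momentsD S3 I12; have S5 := all_momentsD S4 I13.
have i := all_moments_integrable.
rewrite (RintegralD measurableT (i _ _ _ _ _ S5) (i _ _ _ _ _ I23)).
rewrite (RintegralD measurableT (i _ _ _ _ _ S4) (i _ _ _ _ _ I13)).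
rewrite (RintegralD measurableT (i _ _ _ _ _ S3) (i _ _ _ _ _ I12)).
rewrite (RintegralD measurableT (i _ _ _ _ _ S2) (i _ _ _ _ _ I33)).
rewrite (RintegralD measurableT (i _ _ _ _ _ I11) (i _ _ _ _ _ I22)).
rewrite (RintegralZl _ measurableT (i _ _ _ _ _ (all_momentsX 2 a1))).
rewrite (RintegralZl _ measurableT (i _ _ _ _ _ (all_momentsX 2 a2))).
rewrite (RintegralZl _ measurableT (i _ _ _ _ _ (all_momentsX 2 a3))).
rewrite (RintegralZl _ measurableT (i _ _ _ _ _ (all_momentsM a1 a2))).
rewrite (RintegralZl _ measurableT (i _ _ _ _ _ (all_momentsM a1 a3))).
by rewrite (RintegralZl _ measurableT (i _ _ _ _ _ (all_momentsM a2 a3))).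
Qed.

Lemma covariance_psd x y z :
  0 <= x ^+ 2 * v1 + y ^+ 2 * v2 + z ^+ 2 * v3
       + 2 * x * y * a + 2 * x * z * b + 2 * y * z * c.
Proof. by rewrite -Rintegral_sqr_comb; apply: Rintegral_ge0 => w _; exact: sqr_ge0. Qed.

(** Everything is read from variances of suitable combinations. The expression in the second claim
    is the determinant of the covariance matrix divided by [v2 * v3]. *)
Lemma covariance_det (q := c ^+ 2 / (v2 * v3)) (al := a ^+ 2 / v2) (be := b ^+ 2 / v3)
    (ga := a * b * c / (v2 * v3)) :
  [/\ 0 <= q <= 1, 0 <= v1 * (1 - q) - al - be + 2 * ga & q = 1 -> be = al /\ ga = al].
Proof.
have n2 := lt0r_neq0 v2_gt0; have n3 := lt0r_neq0 v3_gt0; have n1 := lt0r_neq0 v1_gt0.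
have v23 : 0 < v2 * v3 by rewrite mulr_gt0.
pose D := v2 * v3 - c ^+ 2.
have D0 : 0 <= D.
  (* The variance of v3 X2 - c X3 is v3 D. *)
  rewrite -(pmulr_rge0 _ v3_gt0); apply: etrans (covariance_psd 0 v3 (- c)).
  by congr (0 <= _); rewrite /D; ring.
have qE : 1 - q = D / (v2 * v3) by rewrite /q /D; field; rewrite ?n2 ?n3.
have r0 : q = 1 -> a * c = b * v2.
  move=> q1; have {D0} D0 : D = 0.
    by move: qE; rewrite q1 subrr => /esym/eqP; rewrite mulf_eq0 invr_eq0 (gt_eqF v23) orbF => /eqP.
  (* When D = 0 the combination c X2 - v2 X3 has variance 0. The multiple of [X1] added to it
     minimizes the variance, which forces the covariance a c - b v2 with [X1] to vanish. *)
  have := covariance_psd (- (a * c - b * v2) / v1) c (- v2).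
  have -> : (- (a * c - b * v2) / v1) ^+ 2 * v1 + c ^+ 2 * v2 + (- v2) ^+ 2 * v3 +
       2 * (- (a * c - b * v2) / v1) * c * a + 2 * (- (a * c - b * v2) / v1) * - v2 * b +
       2 * c * - v2 * c = v2 * D - (a * c - b * v2) ^+ 2 / v1.
    by rewrite /D; field.
  rewrite D0 mulr0 sub0r oppr_ge0 pmulr_lle0 ?invr_gt0// => le0.
  apply/eqP; rewrite -subr_eq0 -sqrf_eq0 eq_le le0; exact: sqr_ge0.
have qle1 : q <= 1.
  by rewrite -subr_ge0 qE; apply: divr_ge0 => //; exact: ltW.
have q0 : 0 <= q by rewrite divr_ge0 ?sqr_ge0// ltW.
have q1P : q = 1 -> be = al /\ ga = al.
  move=> q1; have acE := r0 q1.
  have cc : c ^+ 2 = v2 * v3 by rewrite -[LHS](divfK (lt0r_neq0 v23)) -/q q1 mul1r.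
  have bE : b = a * c / v2 by rewrite acE mulfK.
  have beE : be = al * (c ^+ 2 / (v2 * v3)) by rewrite /be /al bE; field; rewrite ?n2 ?n3.
  have gaE : ga = al * (c ^+ 2 / (v2 * v3)) by rewrite /ga /al bE; field; rewrite ?n2 ?n3.
  by rewrite beE gaE -/q q1 !mulr1.
split=> //; first by rewrite q0.
have detE : v1 * (1 - q) - al - be + 2 * ga =
    (v1 * D - a ^+ 2 * v3 - b ^+ 2 * v2 + 2 * a * b * c) / (v2 * v3).
  by rewrite /q /al /be /ga /D; field; rewrite ?n2 ?n3.
have [q1|qn1] := eqVneq q 1.
  by have [-> ->] := q1P q1; rewrite q1 subrr mulr0; lra.
have Dgt0 : 0 < D.
  have : 0 < 1 - q by rewrite subr_gt0 lt_neqAle qn1.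
  by rewrite qE pmulr_lgt0// invr_gt0.
rewrite detE; apply: divr_ge0; last exact: ltW.
rewrite -(pmulr_rge0 _ Dgt0).
(* The weights are the cofactors of the first row of the covariance matrix, so the variance is D
   times the determinant. *)
apply: etrans (covariance_psd D (b * c - a * v3) (a * c - b * v2)).
by congr (0 <= _); rewrite /D; ring.
Qed.

Lemma gaussian_moment_inequality m n :
  let K := \int[P]_w (X1 w ^+ 2 * X2 w ^+ (2 * m.+1) * X3 w ^+ (2 * n.+1)) in
  let L := v1 * \int[P]_w X2 w ^+ (2 * m.+1) * \int[P]_w X3 w ^+ (2 * n.+1) in
  L <= K /\ (K = L <-> [/\ a = 0, b = 0 & c = 0]).
Proof.
move=> K L.
have n2 := lt0r_neq0 v2_gt0; have n3 := lt0r_neq0 v3_gt0.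
have [q01 det0 q1P] := covariance_det.
set q := c ^+ 2 / (v2 * v3) in q01 det0 q1P; set al := a ^+ 2 / v2 in det0 q1P.
set be := b ^+ 2 / v3 in det0 q1P; set ga := a * b * c / (v2 * v3) in det0 q1P.
have al0 : 0 <= al by rewrite divr_ge0 ?sqr_ge0// ltW.
have be0 : 0 <= be by rewrite divr_ge0 ?sqr_ge0// ltW.
have abq : al * be * q = ga ^+ 2 by rewrite /al /be /q /ga; field; rewrite ?n2 ?n3.
have := hpoly_quadratic_ineq (ltn0Sn m) (ltn0Sn n) v1_gt0 q01 al0 be0 abq det0 q1P.
set F := (hpoly R m.+1 n.+1).[q]; set f := (hpoly R m.+1 n.+1)^`().[q].
set V := _ + _ => -[leV eqV].
have g2 : gaussian_moments P X2.
  have -> : X2 = (fun w => X2 w + 0 * X3 w + 0 * X1 w).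
    by apply/funext => w; rewrite !mul0r !addr0.
  exact: gX.
have f0 k : 0 < k`!%:R :> R by rewrite ltr0n fact_gt0.
(* After division by the factorials, the joint moment and the product share the factor [ka]; what
   remains is [V] against [v1]. *)
pose ka := v2 ^+ m.+1 * v3 ^+ n.+1 / (2 ^+ (m.+1 + n.+1) * m.+1`!%:R * n.+1`!%:R).
have ka0 : 0 < ka.
  by rewrite divr_gt0// ?mulr_gt0// ?exprn_gt0.
pose fct := (2 * m.+1)`!%:R * (2 * n.+1)`!%:R : R.
have fct0 : 0 < fct by rewrite mulr_gt0.
have := @norm_moment_hpoly _ _ _ P X1 X2 X3 a2 a3 gX v2_gt0 v3_gt0; rewrite -/c -/v2 -/v3 -/q => nmE.
have KE : K / fct = ka * V.
  have -> : K = \int[P]_w (X1 w ^+ 2 * (X2 w ^+ (2 * m.+1) * X3 w ^+ (2 * n.+1))).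
    by apply: eq_Rintegral => w _; rewrite mulrA.
  rewrite (norm_moment_sqr a1 a2 a3 gX) -/v1 -/a -/b.
  rewrite (nmE m.+1 n.+1).1 (nmE m n.+1).1 (nmE m.+1 n).1 (nmE m n).2 -/F -/f.
  (* The terms in a^2 and b^2 carry the polynomials with one index lowered; the contiguous relation
     brings them back to [F] and [f]. *)
  have /(congr1 (horner^~ q)) := hpolySr R m.+1 n.
  have /(congr1 (horner^~ q)) := hpolySr R n.+1 m.
  rewrite !(hpolyC R n.+1) !hornerD !hornerM !hornerC !hornerX -/F -/f.
  set F2 := _.[q]; set F1 := _.[q] => e2 e1.
  have -> : V = v1 * F + al * (2 * (m.+1%:R * F2)) + be * (2 * (n.+1%:R * F1)) + 4 * ga * f.
    rewrite /V; apply: (eq_by_sub (k := 2 * al) e2); apply: (eq_by_sub (k := 2 * be) e1).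
    by ring.
  rewrite /ka /al /be /ga !exprD !exprS !factS !natrM.
  have := f0 m; have := f0 n; have : 0 < 2 ^+ m :> R by rewrite exprn_gt0.
  have : 0 < 2 ^+ n :> R by rewrite exprn_gt0.
  have : 0 < m.+1%:R :> R by rewrite ltr0n.
  have : 0 < n.+1%:R :> R by rewrite ltr0n.
  move: m`!%:R n`!%:R m.+1%:R n.+1%:R (2 ^+ m) (2 ^+ n) (v2 ^+ m) (v3 ^+ n).
  move=> x1 x2 x3 x4 x5 x6 x7 x8 h4 h3 h6 h5 h2 h1.
  by field; rewrite !lt0r_neq0.
have LE : L / fct = ka * v1.
  (* [X3] alone is not of the form X2 + t X3 + s X1, so its moments are taken from [norm_moment]
     with first index 0. *)
  have g3 : \int[P]_w X3 w ^+ (2 * n.+1) / (2 * n.+1)`!%:R = v3 ^+ n.+1 / (2 ^+ n.+1 * n.+1`!%:R).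
    have := (nmE 0%N n.+1).1; rewrite /norm_moment.
    rewrite muln0 fact0 mul1r hpolyC hpoly_0r hornerC expr0 add0n !mul1r !mulr1 => <-.
    by congr (_ / _); apply: eq_Rintegral => w _; rewrite expr0 mul1r.
  have -> : L / fct = v1 * (\int[P]_w X2 w ^+ (2 * m.+1) / (2 * m.+1)`!%:R) *
      (\int[P]_w X3 w ^+ (2 * n.+1) / (2 * n.+1)`!%:R).
    by rewrite /L /fct; field; rewrite !lt0r_neq0.
  rewrite g2 g3 -/v2 /ka exprD.
  by field; rewrite !lt0r_neq0// exprn_gt0.
split.
  by rewrite -(ler_pM2r (_ : 0 < fct^-1)) ?invr_gt0// KE LE ler_pM2l.
have KL : K = L <-> V = v1.
  split=> [KL|Vv].
    by apply: (mulfI (lt0r_neq0 ka0)); rewrite -KE -LE KL.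
  have fi : fct^-1 != 0 by rewrite invr_eq0 lt0r_neq0.
  by apply: (mulIf fi); rewrite KE LE Vv.
rewrite KL; split=> [/eqV[/eqP + /eqP + /eqP]|[a0 b0 c0]].
  rewrite /al /be /q !mulf_eq0 !invr_eq0 !mulf_eq0 (gt_eqF v2_gt0) (gt_eqF v3_gt0) !orbF !orbb.
  by move=> /eqP-> /eqP-> /eqP->.
have q0 : q = 0 by rewrite /q c0 expr0n/= mul0r.
have al_eq0 : al = 0 by rewrite /al a0 expr0n/= mul0r.
have be_eq0 : be = 0 by rewrite /be b0 expr0n/= mul0r.
have ga_eq0 : ga = 0 by rewrite /ga a0 !mul0r.
by rewrite /V al_eq0 be_eq0 ga_eq0 mulr0 !mul0r !addr0 /F q0 horner_hpoly0 mulr1.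
Qed.

End moment_inequality.

(** * Fourier uniqueness *)

Lemma Rintegral_dominated_cvg d (T : measurableType d) (R : realType)
    (mu : {measure set T -> \bar R}) (f_ : nat -> T -> R) (f g : T -> R) :
  (forall n, measurable_fun [set: T] (f_ n)) ->
  (forall w, f_ n w @[n --> \oo] --> f w) ->
  mu.-integrable [set: T] (EFin \o g) ->
  (forall n w, `|f_ n w| <= g w) ->
  \int[mu]_w f_ n w @[n --> \oo] --> \int[mu]_w f w.
Proof.
move=> mf_ f_f Ig fg.
have mf : measurable_fun [set: T] f.
  by apply: (measurable_fun_cvg mf_) => w _; exact: f_f.
have [|||||If _ cvgI] := @dominated_convergence _ T R mu setT measurableT
  (fun n => EFin \o f_ n) (EFin \o f) (EFin \o g).
- by move=> n; apply/measurable_EFinP.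
- by apply/measurable_EFinP.
- by apply: aeW => w _; apply: cvg_EFin; [exact: nearW|exact: f_f].
- by [].
- by apply: aeW => w n _; rewrite /= lee_fin.
apply: fine_cvg; rewrite /Rintegral fineK //.
exact: integrable_fin_num.
Qed.

(** * Characteristic functions from moments *)

Lemma series_exp_coeff_le_expR (R : realType) (x : R) n : 0 <= x ->
  series (exp_coeff x) n <= expR x.
Proof.
move=> x0; apply: nondecreasing_cvgn_le; last exact: is_cvg_series_exp_coeff.
by apply: nondecreasing_series => i _ _; exact: exp_coeff_ge0.
Qed.

Section characteristic_function.
Context d (T : measurableType d) (R : realType) (P : probability T R) (Y : T -> R) (v : R).
Hypotheses (eY : exp_moments P Y) (Y0 : \int[P]_w Y w = 0).
Hypothesis YSS : forall k, \int[P]_w Y w ^+ k.+2 = k.+1%:R * v * \int[P]_w Y w ^+ k.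

Let Y_odd k : \int[P]_w Y w ^+ k.*2.+1 = 0.
Proof.
elim: k => [|k IH]; first by under eq_Rintegral do rewrite expr1.
by rewrite doubleS YSS IH mulr0.
Qed.

Let Y_even k : \int[P]_w Y w ^+ k.*2 / k.*2`!%:R = v ^+ k / (2 ^+ k * k`!%:R).
Proof.
by rewrite -muln2 mulnC (centered_even_moments (Rintegral_expr0 P Y) YSS).
Qed.

Let integrable_series (u : nat -> nat) (e : nat -> R) n :
  \int[P]_w (\sum_(0 <= k < n) e k * Y w ^+ u k) = \sum_(0 <= k < n) e k * \int[P]_w Y w ^+ u k.
Proof.
under eq_Rintegral do rewrite big_mkord.
have IY k := integrable_expr eY k.
rewrite (@Rintegral_sum _ T R P n (fun i w => e i * Y w ^+ u i) _).2.
  by rewrite big_mkord; apply: eq_bigr => i _; rewrite (RintegralZl _ measurableT (IY (u i))).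
move=> i; have := integrableZl measurableT (e i) (IY (u i)).
by apply: eq_integrable.
Qed.

Lemma Rintegral_sin : \int[P]_w sin (Y w) = 0.
Proof.
have mY := eY.1.
have : \int[P]_w series (sin_coeff' (Y w)) n @[n --> \oo] --> \int[P]_w sin (Y w).
  apply: (@Rintegral_dominated_cvg _ T R P (fun n w => series (sin_coeff' (Y w)) n)
    (fun w => sin (Y w)) (fun w => expR `|Y w|)).
  - move=> n; apply: measurable_sum => k; apply: measurable_funM => //.
    by apply: measurable_funM => //; exact: measurable_funX.
  - by move=> w; exact: cvg_sin_coeff'.
  - have := integrable_expR_norm eY ler01; apply: eq_integrable => // w _.
    by rewrite mul1r.
  (* In absolute value, the first n sine terms are the odd ones among the first 2n terms of the
     exponential series at |y|. *)
  - move=> n w; apply: le_trans (series_exp_coeff_le_expR (2 * n) (normr_ge0 (Y w))).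
    elim: n => [|n IH]; first by rewrite /series/= muln0 !big_geq// normr0.
    rewrite mulnS /series/= !big_nat_recr//= (le_trans (ler_normD _ _))// -addrA lerD//.
    rewrite /exp_coeff /sin_coeff' /= normrM normfV !normrM normrX normrN1 expr1n mul1r normr_nat.
    by rewrite normrX mul2n lerDr divr_ge0// exprn_ge0.
rewrite (_ : (fun n => _) = cst 0); first by move=> /cvg_lim => <- //; rewrite lim_cst.
apply/funext => n /=.
under eq_Rintegral => w _.
  rewrite /series/= /sin_coeff'; under eq_bigr do rewrite mulrAC.
  over.
by rewrite integrable_series big1// => k _; rewrite Y_odd mulr0.
Qed.

(** Since E[Y^(2k)]/(2k)! = v^k/(2^k k!), termwise integration turns the cosine series into the
    exponential series at -v/2; exp(|Y|) dominates the partial sums. *)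
Lemma Rintegral_cos : \int[P]_w cos (Y w) = expR (- v / 2).
Proof.
have mY := eY.1.
have : \int[P]_w series (cos_coeff' (Y w)) n @[n --> \oo] --> \int[P]_w cos (Y w).
  apply: (@Rintegral_dominated_cvg _ T R P (fun n w => series (cos_coeff' (Y w)) n)
    (fun w => cos (Y w)) (fun w => expR `|Y w|)).
  - move=> n; apply: measurable_sum => k; apply: measurable_funM => //.
    by apply: measurable_funM => //; exact: measurable_funX.
  - by move=> w; exact: cvg_cos_coeff'.
  - have := integrable_expR_norm eY ler01; apply: eq_integrable => // w _.
    by rewrite mul1r.
  - move=> n w; apply: le_trans (series_exp_coeff_le_expR (2 * n) (normr_ge0 (Y w))).
    elim: n => [|n IH]; first by rewrite /series/= muln0 !big_geq// normr0.
    rewrite mulnS /series/= !big_nat_recr//= (le_trans (ler_normD _ _))// -addrA lerD//.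
    rewrite /exp_coeff /cos_coeff' /= normrM normfV !normrM normrX normrN1 expr1n mul1r normr_nat.
    by rewrite normrX mul2n lerDl divr_ge0// exprn_ge0.
rewrite (_ : (fun n => _) = series (exp_coeff (- v / 2))).
  by move=> /cvg_lim => <-.
apply/funext => n /=.
under eq_Rintegral => w _.
  rewrite /series/= /cos_coeff'; under eq_bigr do rewrite mulrAC.
  over.
rewrite integrable_series; apply: eq_bigr => k _.
rewrite -mulrA [_^-1 * _]mulrC Y_even /exp_coeff/= exprMn exprNn exprVn.
by rewrite invfM !mulrA.
Qed.

End characteristic_function.

Lemma Rintegral_Fubini d1 d2 (T1 : measurableType d1) (T2 : measurableType d2) (R : realType)
    (m1 : {sigma_finite_measure set T1 -> \bar R})
    (m2 : {sigma_finite_measure set T2 -> \bar R}) (f : T1 * T2 -> R) :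
  (m1 \x m2)%E.-integrable [set: T1 * T2] (EFin \o f) ->
  (forall x, m2.-integrable [set: T2] (fun y => (f (x, y))%:E)) ->
  (forall y, m1.-integrable [set: T1] (fun x => (f (x, y))%:E)) ->
  \int[m1]_x \int[m2]_y f (x, y) = \int[m2]_y \int[m1]_x f (x, y).
Proof.
move=> If I2 I1; rewrite /Rintegral; congr fine.
transitivity (\int[m1]_x \int[m2]_y (f (x, y))%:E)%E.
  by apply: eq_integral => x _; rewrite fineK//; exact: integrable_fin_num.
rewrite (Fubini If); apply: eq_integral => y _.
by rewrite fineK//; exact: integrable_fin_num.
Qed.

Lemma integrable_Rintegral_prod d1 d2 (T1 : measurableType d1) (T2 : measurableType d2)
    (R : realType) (m1 : {sigma_finite_measure set T1 -> \bar R})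
    (m2 : {sigma_finite_measure set T2 -> \bar R}) (f : T1 * T2 -> R) :
  (m1 \x m2)%E.-integrable [set: T1 * T2] (EFin \o f) ->
  (forall x, m2.-integrable [set: T2] (fun y => (f (x, y))%:E)) ->
  m1.-integrable [set: T1] (fun x => (\int[m2]_y f (x, y))%:E).
Proof.
move=> If I2; apply: eq_integrable (integrable_fubini_F If) => // x _.
by rewrite fineK//; exact: integrable_fin_num.
Qed.

Lemma bounded_integrable d (T : measurableType d) (R : realType) (P : probability T R)
    (f : T -> R) (M : R) :
  measurable_fun [set: T] f -> (forall w, `|f w| <= M) ->
  P.-integrable [set: T] (EFin \o f).
Proof.
move=> mf fM; have := finite_measure_integrable_cst P M measurableT.
apply: le_integrable => //.
  exact/measurable_EFinP.
by move=> w _ /=; rewrite lee_fin (le_trans (fM w))// ler_norm.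
Qed.

Lemma normal_prob_cos (R : realType) (s a : R) : s != 0 ->
  \int[normal_prob 0 s]_z cos (a * z) = expR (- (s * a) ^+ 2 / 2).
Proof.
move=> s0.
have mY : measurable_fun [set: measurableTypeR R] (fun z : measurableTypeR R => a * z).
  exact: measurable_funM.
have [|eY Y0 YSS] := @mgf_moments _ (measurableTypeR R) R (normal_prob 0 s)
    (fun z => a * z) 0 (s * a) mY.
  move=> t; under eq_integral do rewrite mulrA.
  by rewrite normal_prob_mgf//; congr (expR _)%:E; ring.
have YSS' k : \int[normal_prob 0 s]_w (a * w) ^+ k.+2 =
    k.+1%:R * (s * a) ^+ 2 * \int[normal_prob 0 s]_w (a * w) ^+ k.
  by rewrite YSS mul0r add0r.
exact: (@Rintegral_cos _ (measurableTypeR R) R (normal_prob 0 s) _ _ eY YSS').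
Qed.

Lemma measurable_normal_pdf_prod d (T : measurableType d) (R : realType) (X : T -> R) (s : R) :
  measurable_fun [set: T] X -> s != 0 ->
  measurable_fun [set: T * measurableTypeR R] (fun p => normal_pdf (X p.1) s p.2).
Proof.
move=> mX sn0.
have m1 : measurable_fun [set: T * measurableTypeR R] (X \o fst).
  by apply: measurableT_comp => //; exact: measurable_fst.
have m2 : measurable_fun [set: T * measurableTypeR R] (snd : T * measurableTypeR R -> R).
  exact: measurable_snd.
under eq_fun do rewrite normal_pdfE//.
apply: measurable_funM => //; apply: measurableT_comp => //.
apply: measurable_funM => //; apply: measurableT_comp => //.
by apply: measurable_funX; exact: measurable_funB.
Qed.

Lemma measurable_normal_prob_mean d (T : measurableType d) (R : realType) (X : T -> R) (s : R)
    (A : set R) : measurable_fun [set: T] X -> s != 0 -> measurable A ->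
  measurable_fun [set: T] (fun w => fine (normal_prob (X w) s A)).
Proof.
move=> mX sn0 mA; apply: measurableT_comp; first exact: fine_measurable.
pose f (p : T * measurableTypeR R) := (normal_pdf (X p.1) s p.2 * \1_A p.2)%:E.
rewrite (_ : (fun w => _) = (fun w => \int[lebesgue_measure]_y f (w, y))%E).
  apply: (@measurable_fun_fubini_tonelli_F _ _ T (measurableTypeR R) R lebesgue_measure f).
    apply/measurable_EFinP/measurable_funM; first exact: measurable_normal_pdf_prod.
    by apply: measurableT_comp; [exact: measurable_indic|exact: measurable_snd].
  by move=> p; rewrite lee_fin mulr_ge0 ?normal_pdf_ge0.
apply/funext => w; rewrite /normal_prob integral_mkcond; apply: eq_integral => y _.
by rewrite patchE /f/= indicE; case: ifPn; rewrite ?mulr1 ?mulr0.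
Qed.

Section fourier_uniqueness.
Context d (T : measurableType d) (R : realType) (P : probability T R).
Variables (X V : T -> R) (M : R).
Hypotheses (mX : measurable_fun [set: T] X) (mV : measurable_fun [set: T] V).
Hypothesis VM : forall w, `|V w| <= M.
Hypothesis Vcos : forall t c, \int[P]_w (cos (t * X w - c) * V w) = 0.

Let M0 : 0 <= M. Proof. by rewrite (le_trans _ (VM point)). Qed.

(* The Gaussian kernel is, up to a constant, the characteristic function of [N(0, s^-1)]. *)
Lemma Rintegral_normal_pdf_eq0 (s y : R) : 0 < s ->
  \int[P]_w (normal_pdf (X w) s y * V w) = 0.
Proof.
move=> s0; have sn0 := lt0r_neq0 s0; have isn0 : s^-1 != 0 by rewrite invr_eq0.
pose f (p : T * measurableTypeR R) := cos (p.2 * X p.1 - p.2 * y) * V p.1.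
have fM p : `|f p| <= M by rewrite /f normrM -[leRHS]mul1r ler_pM// cos_max.
have mf : measurable_fun [set: T * measurableTypeR R] f.
  have m1 : measurable_fun [set: T * measurableTypeR R] (X \o fst).
    by apply: measurableT_comp => //; exact: measurable_fst.
  have m2 : measurable_fun [set: T * measurableTypeR R] (snd : T * measurableTypeR R -> R).
    exact: measurable_snd.
  apply: measurable_funM.
    apply: measurableT_comp; first exact: continuous_measurable_fun (@continuous_cos R).
    by apply: measurable_funB; apply: measurable_funM.
  by apply: measurableT_comp => //; exact: measurable_fst.
have If : (P \x normal_prob 0%R s^-1%R)%E.-integrable [set: T * measurableTypeR R] (EFin \o f).
  exact: (@bounded_integrable _ _ R (P \x normal_prob 0%R s^-1%R)%E f M mf fM).
have cosE w z : f (w, z) = cos (z * X w - z * y) * V w by [].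
transitivity (\int[P]_w (normal_peak s * \int[normal_prob 0 s^-1]_z f (w, z))).
  apply: eq_Rintegral => w _; rewrite normal_pdfE// -mulrA; congr (_ * _).
  transitivity ((\int[normal_prob 0 s^-1]_z cos ((X w - y) * z)) * V w).
    rewrite normal_prob_cos//; congr (expR _ * _).
    by field.
  rewrite -RintegralZr//.
    by apply: eq_Rintegral => z _; rewrite cosE; congr (cos _ * _); ring.
  apply: (@bounded_integrable _ (measurableTypeR R) R (normal_prob 0 s^-1)
      (fun z => cos ((X w - y) * z)) 1); last by move=> z; exact: cos_max.
  apply: measurableT_comp; first exact: continuous_measurable_fun (@continuous_cos R).
  exact: measurable_funM.
have I2 w : (normal_prob 0 s^-1).-integrable [set: measurableTypeR R] (fun z => (f (w, z))%:E).
  apply: (@bounded_integrable _ (measurableTypeR R) R (normal_prob 0 s^-1)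
      (fun z => f (w, z)) M); last by move=> z; exact: fM.
  exact: measurableT_comp.
have I1 z : P.-integrable [set: T] (fun w => (f (w, z))%:E).
  apply: (@bounded_integrable _ T R P (fun w => f (w, z)) M); last by move=> w; exact: fM.
  exact: measurableT_comp.
rewrite RintegralZl//; last first.
  exact: integrable_Rintegral_prod If I2.
rewrite (Rintegral_Fubini If I2 I1).
rewrite (@eq_Rintegral _ _ _ _ _ (cst 0)); last by move=> z _; rewrite /f/= Vcos.
by rewrite Rintegral_cst// mul0r mulr0.
Qed.

(** Integrates the vanishing identity of [Rintegral_normal_pdf_eq0] over y <= b and exchanges the
    integrals. *)
Lemma Rintegral_normal_prob_eq0 (s b : R) : 0 < s ->
  \int[P]_w (fine (normal_prob (X w) s `]-oo, b]) * V w) = 0.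
Proof.
move=> s0; have sn0 := lt0r_neq0 s0.
pose A : set (measurableTypeR R) := `]-oo, b]%classic.
have mA : measurable A by exact: measurable_itv.
pose f (p : T * measurableTypeR R) := normal_pdf (X p.1) s p.2 * V p.1 * \1_A p.2.
have mpdf := measurable_normal_pdf_prod mX sn0.
have mf : measurable_fun [set: T * measurableTypeR R] f.
  apply: measurable_funM.
    by apply: measurable_funM => //; apply: measurableT_comp => //; exact: measurable_fst.
  by apply: measurableT_comp; [exact: measurable_indic|exact: measurable_snd].
have pdf_ub x y : `|normal_pdf x s y| <= normal_peak s.
  by rewrite ger0_norm ?normal_pdf_ge0// normal_pdf_ub.
have VA w y : `|V w * \1_A y| <= M.
  rewrite normrM -[leRHS]mulr1 ler_pM// indicE; case: (_ \in _).
    by rewrite normr1.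
  by rewrite normr0.
have fE w y : `|f (w, y)| <= M * normal_pdf (X w) s y.
  by rewrite /f/= -mulrA normrM mulrC ler_pM// ger0_norm ?normal_pdf_ge0.
have IM w : lebesgue_measure.-integrable [set: measurableTypeR R]
    (fun y => (M * normal_pdf (X w) s y)%:E).
  have := integrableZl measurableT M (integrable_normal_pdf (X w) s).
  by apply: eq_integrable.
have If : (P \x lebesgue_measure)%E.-integrable [set: T * measurableTypeR R] (EFin \o f).
  (* The integrand is dominated by [M] times the density, whose integral in y is 1 for every w. *)
  apply/integrable12ltyP; first exact/measurable_EFinP.
  apply: (@le_lt_trans _ _ (\int[P]_w M%:E)%E); last first.
    by rewrite integral_cst// [X in (_ * X)%E](probability_setT P) mule1 ltry.
  apply: ge0_le_integral => //.
  - by move=> w _; exact: integral_ge0.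
  - apply: (@measurable_fun_fubini_tonelli_F _ _ T (measurableTypeR R) R lebesgue_measure
      (abse \o (EFin \o f))) => //.
      by apply: measurableT_comp => //; exact/measurable_EFinP.
    by move=> p; exact: abse_ge0.
  move=> w _; apply: (@le_trans _ _ (\int[lebesgue_measure]_y (M * normal_pdf (X w) s y)%:E)%E).
    apply: ge0_le_integral => //.
    - apply: measurableT_comp => //; apply/measurable_EFinP.
      exact: measurableT_comp.
    - exact: measurable_int (IM w).
    - by move=> y _; rewrite lee_fin fE.
  under eq_integral do rewrite EFinM.
  rewrite integralZl//; last exact: integrable_normal_pdf.
  by rewrite integral_normal_pdf mule1.
have I2 w : lebesgue_measure.-integrable [set: measurableTypeR R] (fun y => (f (w, y))%:E).
  apply: le_integrable (IM w) => //.
    by apply/measurable_EFinP; exact: measurableT_comp.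
  by move=> y _ /=; rewrite lee_fin (le_trans (fE w y))// ler_norm.
have mpdfX y : measurable_fun [set: T] (fun w => normal_pdf (X w) s y).
  exact: (measurableT_comp mpdf (measurable_pair2 y)).
have Ipdf y : P.-integrable [set: T] (EFin \o (fun w => normal_pdf (X w) s y * V w)).
  apply: (@bounded_integrable _ T R P _ (normal_peak s * M)); first exact: measurable_funM.
  by move=> w; rewrite normrM ler_pM.
have I1 y : P.-integrable [set: T] (fun w => (f (w, y))%:E).
  have := integrableZr measurableT (\1_A y) (Ipdf y); exact: eq_integrable.
transitivity (\int[P]_w \int[lebesgue_measure]_y f (w, y)).
  apply: eq_Rintegral => w _.
  have IA : lebesgue_measure.-integrable A (EFin \o normal_pdf (X w) s).
    by apply: (integrableS _ _ (@subsetT _ _)) => //; exact: integrable_normal_pdf.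
  rewrite -[fine _]/(\int[lebesgue_measure]_(y in A) normal_pdf (X w) s y).
  rewrite -RintegralZr// Rintegral_mkcond; apply: eq_Rintegral => y _.
  by rewrite /f/= patchE indicE; case: ifPn; rewrite ?mulr1 ?mulr0.
rewrite (Rintegral_Fubini If I2 I1).
rewrite (@eq_Rintegral _ _ _ _ _ (cst 0)); last first.
  move=> y _; rewrite /f/= (RintegralZr _ measurableT (Ipdf y)).
  by rewrite Rintegral_normal_pdf_eq0// mul0r.
by rewrite Rintegral_cst// mul0r.
Qed.

End fourier_uniqueness.

(** Exponential Markov inequality: the condition on [A] bounds its indicator by exp(ty - a). The
    sign of [t] is free, so both tails are covered. *)
Lemma normal_prob_chernoff (R : realType) (x s t a : R) (A : set R) : s != 0 ->
  measurable A -> (forall y, A y -> 0 <= t * y - a) ->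
  fine (normal_prob x s A) <= expR (x * t + s ^+ 2 * t ^+ 2 / 2 - a).
Proof.
move=> s0 mA At; rewrite -lee_fin fineK; last exact: fin_num_measure.
have mA' : measurable (A : set (measurableTypeR R)) by [].
have -> : normal_prob x s A = (\int[normal_prob x s]_y (\1_A y)%:E)%E.
  by rewrite integral_indic// setIT.
have -> : (expR (x * t + s ^+ 2 * t ^+ 2 / 2 - a))%:E =
   (\int[normal_prob x s]_y ((expR (- a))%:E * (expR (t * y))%:E))%E.
  rewrite ge0_integralZl//; last first.
    exact/measurable_EFinP/measurable_expR_mul.
  by rewrite normal_prob_mgf// -EFinM -expRD addrC.
apply: ge0_le_integral => //.
- exact/measurable_EFinP/measurable_indic.
- apply/measurable_EFinP/measurable_funM => //.
  exact: measurable_expR_mul.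
move=> y _; rewrite -EFinM lee_fin indicE -expRD.
have [Ay|nAy] := boolP (y \in A); last by rewrite expR_ge0.
rewrite -expR0 ler_expR addrC; apply: At; exact/set_mem.
Qed.

(* The end point is shifted by [1/(n+1)], large against the standard deviation
   [1/(n+1)^2], so that the limit at [x = b] is 0 rather than 1/2. *)
Lemma normal_prob_halfline_cvg (R : realType) (b x : R) :
  fine (normal_prob x (n.+1%:R^-1 ^+ 2) `]-oo, b - n.+1%:R^-1]) @[n --> \oo] -->
  (\1_(`]-oo, b[%classic : set R) x : R).
Proof.
pose e (n : nat) : R := n.+1%:R^-1.
have e0 n : 0 < e n by rewrite invr_gt0 ltr0n.
have bound n : expR (2^-1 - (e n)^-1) <= expR 2^-1 * e n.
  rewrite /e invrK expRB ler_pM2l ?expR_gt0// lef_pV2 ?posrE ?expR_gt0//.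
  by rewrite (le_trans _ (expR_ge1Dx _))// lerDr.
have cvg_bound : expR 2^-1 * e n @[n --> \oo] --> (0 : R).
  rewrite -[X in _ --> X](mulr0 (expR 2^-1)).
  by apply: cvgM; [exact: cvg_cst|exact: cvg_harmonic].
have fN n (A : set (measurableTypeR R)) : measurable A ->
    normal_prob x (e n ^+ 2) A \is a fin_num.
  by move=> mA; exact: fin_num_measure.
have sn0 n : e n ^+ 2 != 0 by rewrite expf_neq0// lt0r_neq0.
have tail_left n : b <= x -> fine (normal_prob x (e n ^+ 2) `]-oo, b - e n]) <= expR 2^-1 * e n.
  move=> bx; apply: le_trans (bound n).
  (* With standard deviation s = e_n^2, the slope -1/s makes s^2 t^2/2 equal to 1/2, and the gap e_n
     from the mean contributes -e_n/s = -1/e_n. *)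
  pose t := - (e n ^+ 2)^-1.
  apply: le_trans (@normal_prob_chernoff R x (e n ^+ 2) t (t * (x - e n)) _ (sn0 n) _ _) _ => //.
    move=> y; rewrite /= in_itv/= => yb; rewrite -mulrBr /t mulNr oppr_ge0.
    by rewrite pmulr_rle0 ?invr_gt0 ?exprn_gt0//; lra.
  rewrite ler_expR le_eqVlt; apply/orP; left; apply/eqP.
  by rewrite /t; field; rewrite lt0r_neq0.
have tail_right n : x + e n <= b - e n ->
    1 - fine (normal_prob x (e n ^+ 2) `]-oo, b - e n]) <= expR 2^-1 * e n.
  move=> bx; apply: le_trans (bound n).
  pose t := (e n ^+ 2)^-1.
  have -> : 1 - fine (normal_prob x (e n ^+ 2) `]-oo, b - e n]) =
      fine (normal_prob x (e n ^+ 2) `]b - e n, +oo[).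
    rewrite -setCitvl probability_setC//.
    have F : normal_prob x (e n ^+ 2) `]-oo, b - e n] \is a fin_num.
      by apply: fN; exact: measurable_itv.
    by rewrite [RHS]fineB.
  apply: le_trans (@normal_prob_chernoff R x (e n ^+ 2) t (t * (x + e n)) _ (sn0 n) _ _) _ => //.
    move=> y; rewrite /= in_itv/= andbT => yb; rewrite -mulrBr /t.
    by rewrite pmulr_rge0 ?invr_gt0 ?exprn_gt0//; lra.
  rewrite ler_expR le_eqVlt; apply/orP; left; apply/eqP.
  by rewrite /t; field; rewrite lt0r_neq0.
have h01 n : 0 <= fine (normal_prob x (e n ^+ 2) `]-oo, b - e n]) <= 1.
  rewrite fine_ge0//= -lee_fin fineK; last exact: fN.
  exact: probability_le1.
have cvge : e n @[n --> \oo] --> (0 : R) by exact: cvg_harmonic.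
rewrite indicE; have [bx|bx] := leP b x.
  rewrite memNset; last by rewrite /= in_itv/=; apply/negP; rewrite -leNgt.
  apply: (@squeeze_cvgr _ _ _ _ (cst 0) (fun n => expR 2^-1 * e n)) => //; last exact: cvg_cst.
  by apply: nearW => n; rewrite tail_left// andbT; case/andP: (h01 n).
rewrite mem_set; last by rewrite /= in_itv/=.
apply: (@squeeze_cvgr _ _ _ _ (fun n => 1 - expR 2^-1 * e n) (cst 1)) => //.
- have : \forall n \near \oo, `|0 - e n| < (b - x) / 2.
    by move/cvgrPdist_lt : cvge; apply; lra.
  apply: filterS => n; rewrite sub0r normrN gtr0_norm// => en.
  have := tail_right n; have /andP[_ ->] := h01 n; lra.
- rewrite -[X in _ --> X](subr0 (1 : R)); apply: cvgB; [exact: cvg_cst|exact: cvg_bound].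
- exact: cvg_cst.
Qed.

Section fourier_uniqueness_sets.
Context d (T : measurableType d) (R : realType) (P : probability T R).
Variables (X V : T -> R) (M : R).
Hypotheses (mX : measurable_fun [set: T] X) (mV : measurable_fun [set: T] V).
Hypothesis VM : forall w, `|V w| <= M.
Hypothesis Vcos : forall t c, \int[P]_w (cos (t * X w - c) * V w) = 0.

Let mind (B : set R) : measurable B -> measurable_fun [set: T] (fun w => \1_B (X w) * V w).
Proof.
move=> mB; apply: measurable_funM => //.
by apply: measurableT_comp => //; exact: measurable_indic.
Qed.

Let ind_le (B : set R) w : `|\1_B (X w) * V w| <= M.
Proof.
rewrite normrM -[leRHS]mul1r ler_pM// indicE; case: (_ \in _).
  by rewrite normr1.
by rewrite normr0.
Qed.

Let Iind (B : set R) : measurable B ->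
  P.-integrable [set: T] (EFin \o (fun w => \1_B (X w) * V w)).
Proof. by move=> mB; apply: bounded_integrable (ind_le B); exact: mind. Qed.

Let IM : P.-integrable [set: T] (EFin \o cst M).
Proof. exact: finite_measure_integrable_cst. Qed.

Lemma Rintegral_halfline_eq0 (b : R) : \int[P]_w (\1_`]-oo, b[%classic (X w) * V w) = 0.
Proof.
pose g n w : R := fine (normal_prob (X w) (n.+1%:R^-1 ^+ 2) `]-oo, b - n.+1%:R^-1]) * V w.
have : \int[P]_w g n w @[n --> \oo] --> \int[P]_w (\1_`]-oo, b[%classic (X w) * V w).
  apply: (@Rintegral_dominated_cvg _ T R P g _ (cst M)) => //.
  - move=> n; apply: measurable_funM => //.
    apply: (measurable_normal_prob_mean mX _ (measurable_itv _)).
    by rewrite expf_neq0// invr_eq0.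
  - move=> w; apply: cvgM; last exact: cvg_cst.
    exact: normal_prob_halfline_cvg.
  - move=> n w; rewrite /g normrM -[leRHS]mul1r ler_pM//.
    have F : normal_prob (X w) (n.+1%:R^-1 ^+ 2) `]-oo, b - n.+1%:R^-1] \is a fin_num.
      by apply: fin_num_measure; exact: measurable_itv.
    rewrite ger0_norm ?fine_ge0// -lee_fin fineK//.
    by apply: probability_le1; exact: measurable_itv.
rewrite (_ : (fun n => _) = cst 0); first by move=> /cvg_lim => <- //; rewrite lim_cst.
apply/funext => n; apply: (Rintegral_normal_prob_eq0 mX mV VM Vcos).
by rewrite exprn_gt0// invr_gt0.
Qed.

(** The signed measure B -> E[1_B(X) V] has zero Fourier transform, the phase in [Vcos] covering
    sines too. It vanishes on the open half-lines, a pi-system generating the Borel sets, and its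
    null values form a lambda-system. *)
Lemma fourier_uniqueness (E : set R) : measurable E -> \int[P]_w (\1_E (X w) * V w) = 0.
Proof.
move=> mE.
pose H : set (set R) := [set B | measurable B /\ \int[P]_w (\1_B (X w) * V w) = 0].
(* With t = c = 0 the cosine is 1; this settles the whole space. *)
have V0 : \int[P]_w V w = 0.
  by rewrite -(Vcos 0 0); apply: eq_Rintegral => w _; rewrite mul0r subr0 cos0 mul1r.
have HT : H setT.
  split=> //; rewrite -V0; apply: eq_Rintegral => w _.
  by rewrite indicT mul1r.
have lamH : lambda_system setT H.
  split=> //.
  - move=> A B BA [mA A0] [mB B0]; split; first exact: measurableD.
    transitivity (\int[P]_w (\1_A (X w) * V w - \1_B (X w) * V w)).
      apply: eq_Rintegral => w _; rewrite -mulrBl; congr (_ * _).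
      rewrite !indicE in_setD; have [XB|XB] := boolP (X w \in B); last by rewrite subr0 andbT.
      by rewrite (mem_set (BA _ (set_mem XB))) andbF subrr.
    rewrite RintegralB//; [|exact: Iind..].
    by rewrite A0 B0 subrr.
  - move=> F ndF HF.
    have mF n : measurable (F n) by have [] := HF n.
    split; first exact: bigcupT_measurable.
    have : \int[P]_w (\1_(F n) (X w) * V w) @[n --> \oo] -->
        \int[P]_w (\1_(\bigcup_n F n) (X w) * V w).
      apply: (@Rintegral_dominated_cvg _ T R P (fun n w => \1_(F n) (X w) * V w) _ (cst M)) => //.
      + by move=> n; exact: mind.
      + move=> w; apply: cvgM; last exact: cvg_cst.
        have [[k _ Fk]|nF] := pselect ((\bigcup_n F n) (X w)).
          apply: (cvg_near_cst _); rewrite !indicE mem_set; last by exists k.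
          exists k => // n /= kn; rewrite indicE mem_set//.
          by have /subsetPset := ndF _ _ kn; exact.
        apply: (cvg_near_cst _); rewrite !indicE memNset//.
        apply: nearW => n; rewrite indicE memNset// => Fn; apply: nF; by exists n.
    rewrite (_ : (fun n => _) = cst 0); first by move=> /cvg_lim => <- //; rewrite lim_cst.
    by apply/funext => n; have [] := HF n.
have GH : @RGenInftyO.G R `<=` H.
  move=> _ [x ->]; split; first exact: measurable_itv.
  exact: Rintegral_halfline_eq0.
have GI : setI_closed (@RGenInftyO.G R).
  move=> _ _ [x ->] [y ->]; exists (Order.min x y).
  apply/seteqP; split => z /=; rewrite !in_itv/= lt_min; first by case=> -> ->.
  by move/andP.
apply: (lambda_system_subset GI lamH GH _ _).2 => //.
have : (@ocitv R).-sigma.-measurable E by exact: mE.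
by rewrite RGenInftyO.measurableE.
Qed.

End fourier_uniqueness_sets.

(** Fourier uniqueness for V = W - r: a factorization against all cosines of [X] passes to all
    indicators. *)
Lemma Rintegral_indic_mul_factor d (T : measurableType d) (R : realType) (P : probability T R)
    (X W : T -> R) (M r : R) (e : R -> R -> R) :
  measurable_fun [set: T] X -> measurable_fun [set: T] W -> (forall w, `|W w| <= M) ->
  (forall t c, \int[P]_w cos (t * X w - c) = e t c) ->
  (forall t c, \int[P]_w (cos (t * X w - c) * W w) = e t c * r) ->
  forall B, measurable B -> \int[P]_w (\1_B (X w) * W w) = \int[P]_w \1_B (X w) * r.
Proof.
move=> mX mW WM Ec EcW B mB.
have mcos t c : measurable_fun [set: T] (fun w => cos (t * X w - c)).
  apply: measurableT_comp; first exact: continuous_measurable_fun (@continuous_cos R).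
  by apply: measurable_funB => //; exact: measurable_funM.
have mind : measurable_fun [set: T] (fun w => \1_B (X w) : R).
  by apply: measurableT_comp => //; exact: measurable_indic.
have ind1 w : `|\1_B (X w) : R| <= 1.
  by rewrite indicE; case: (_ \in _); rewrite ?normr1 ?normr0.
have I1 (g : T -> R) : measurable_fun [set: T] g -> (forall w, `|g w| <= 1) ->
    P.-integrable [set: T] (EFin \o (fun w => g w * r)).
  move=> mg g1; apply: (@bounded_integrable _ T R P _ `|r|); first exact: measurable_funM.
  by move=> w; rewrite normrM -[leRHS]mul1r ler_pM.
have I2 (g : T -> R) : measurable_fun [set: T] g -> (forall w, `|g w| <= 1) ->
    P.-integrable [set: T] (EFin \o (fun w => g w * W w)).
  move=> mg g1; apply: (@bounded_integrable _ T R P _ M); first exact: measurable_funM.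
  by move=> w; rewrite normrM -[leRHS]mul1r ler_pM.
have I0 (g : T -> R) : measurable_fun [set: T] g -> (forall w, `|g w| <= 1) ->
    P.-integrable [set: T] (EFin \o g).
  by move=> mg g1; exact: (@bounded_integrable _ T R P _ 1).
have cos1 t c w : `|cos (t * X w - c)| <= 1 by exact: cos_max.
pose V w := W w - r.
have mV : measurable_fun [set: T] V by exact: measurable_funB.
have VM w : `|V w| <= M + `|r| by rewrite (le_trans (ler_normB _ _))// lerD2r.
have split_int (g : T -> R) : measurable_fun [set: T] g -> (forall w, `|g w| <= 1) ->
    \int[P]_w (g w * V w) = \int[P]_w (g w * W w) - \int[P]_w g w * r.
  move=> mg g1; transitivity (\int[P]_w (g w * W w - g w * r)).
    by apply: eq_Rintegral => w _; rewrite /V mulrBr.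
  rewrite (RintegralB measurableT (I2 g mg g1) (I1 g mg g1)).
  by rewrite (RintegralZr _ measurableT (I0 g mg g1)).
have Vcos t c : \int[P]_w (cos (t * X w - c) * V w) = 0.
  by rewrite split_int// EcW Ec subrr.
have := fourier_uniqueness mX mV VM Vcos mB.
by rewrite split_int// => /eqP; rewrite subr_eq0 => /eqP.
Qed.

(** * Independence *)

(** The product rule identifies the law of (X, Y) with the product law; nonnegativity then lets
    Tonelli apply without integrability. *)
Lemma integral_mul_independent d (T : measurableType d) (R : realType) (P : probability T R)
    (X Y : {RV P >-> R}) (f g : R -> R) :
  (forall A B, measurable A -> measurable B ->
    P (X @^-1` A `&` Y @^-1` B) = (P (X @^-1` A) * P (Y @^-1` B))%E) ->
  measurable_fun [set: R] f -> measurable_fun [set: R] g ->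
  (forall x, 0 <= f x) -> (forall x, 0 <= g x) ->
  (\int[P]_w (f (X w) * g (Y w))%:E = \int[P]_w (f (X w))%:E * \int[P]_w (g (Y w))%:E)%E.
Proof.
move=> indep mf mg f0 g0.
have mXY : measurable_fun [set: T] (fun w => (X w, Y w)) by exact: measurable_fun_pair.
have law C : measurable C ->
    P ((fun w => (X w, Y w)) @^-1` C) = (distribution P X \x distribution P Y)%E C.
  move=> mC.
  pose XY : {mfun T >-> (R * R)%type} := mfun_Sub (mem_set mXY).
  by rewrite (@product_measure_unique _ _ _ _ _ (distribution P X) (distribution P Y)
    (distribution P XY)).
have mfg : measurable_fun [set: R * R] (fun p => (f p.1 * g p.2)%:E).
  by apply/measurable_EFinP/measurable_funM; apply: measurableT_comp.
rewrite (@ge0_integral_law _ _ _ _ _ P (distribution P X \x distribution P Y)%E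
  (fun w => (X w, Y w)) (fun p => (f p.1 * g p.2)%:E) mXY mfg _ law); last first.
  by move=> p; rewrite lee_fin mulr_ge0.
rewrite fubini_tonelli1//=; last by move=> p; rewrite lee_fin mulr_ge0.
rewrite /fubini_F/=.
have mf' : measurable_fun [set: R] (EFin \o f) by exact/measurable_EFinP.
have mg' : measurable_fun [set: R] (EFin \o g) by exact/measurable_EFinP.
have g0' y : (0 <= (g y)%:E)%E by rewrite lee_fin.
have f0' x : (0 <= (f x)%:E)%E by rewrite lee_fin.
have inner x : (\int[distribution P Y]_y (f x * g y)%:E =
    (f x)%:E * \int[distribution P Y]_y (g y)%:E)%E.
  by rewrite -ge0_integralZl//; apply: eq_integral => y _; rewrite EFinM.
under eq_integral do rewrite inner.
rewrite ge0_integralZr//; last exact: integral_ge0.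
by rewrite !ge0_integral_distribution.
Qed.

Section centered_gaussian_vector.
Context d (T : measurableType d) (R : realType) (P : probability T R).
Variables X1 X2 X3 : {RV P >-> R}.
Hypothesis gX : centered_gaussian_vector [tuple X1; X2; X3].

Let lin (a1 a2 a3 : R) w := a1 * X1 w + a2 * X2 w + a3 * X3 w.

Let mlin a1 a2 a3 : measurable_fun [set: T] (lin a1 a2 a3).
Proof.
by rewrite /lin; apply: measurable_funD; [apply: measurable_funD|]; exact: measurable_funM.
Qed.

Let lin_mgf a1 a2 a3 : exists m s : R, forall t,
  (\int[P]_w (expR (t * lin a1 a2 a3 w))%:E = (expR (m * t + s ^+ 2 * t ^+ 2 / 2))%:E)%E.
Proof.
have [gJ _ _] := gX; have := gJ (fun i => nth 0 [:: a1; a2; a3] i).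
rewrite (_ : (fun w => _) = lin a1 a2 a3); first exact: gaussian_RV_mgf.
by apply/funext => w; rewrite !big_ord_recl big_ord0 /lin/= addr0 addrA.
Qed.

Let lin_exp_moments a1 a2 a3 : exp_moments P (lin a1 a2 a3).
Proof.
have [m [s mgf]] := lin_mgf a1 a2 a3.
by have [] := mgf_moments (mlin a1 a2 a3) mgf.
Qed.

Let e1 : lin 1 0 0 = X1.
Proof. by apply/funext => w; rewrite /lin; ring. Qed.
Let e2 : lin 0 1 0 = X2.
Proof. by apply/funext => w; rewrite /lin; ring. Qed.
Let e3 : lin 0 0 1 = X3.
Proof. by apply/funext => w; rewrite /lin; ring. Qed.

Let x1 : exp_moments P X1. Proof. by rewrite -e1. Qed.
Let x2 : exp_moments P X2. Proof. by rewrite -e2. Qed.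
Let x3 : exp_moments P X3. Proof. by rewrite -e3. Qed.
Let a1 := exp_moments_all_moments x1.
Let a2 := exp_moments_all_moments x2.
Let a3 := exp_moments_all_moments x3.

Let mean0 i : \int[P]_w tnth [tuple X1; X2; X3] i w = 0.
Proof. by have [_ /(_ i) + _] := gX; rewrite /Rintegral unlock => ->. Qed.

Let m1 : \int[P]_w X1 w = 0. Proof. exact: (mean0 ord0). Qed.
Let m2 : \int[P]_w X2 w = 0. Proof. exact: (mean0 (lift ord0 ord0)). Qed.
Let m3 : \int[P]_w X3 w = 0. Proof. exact: (mean0 (lift ord0 (lift ord0 ord0))). Qed.

Let lin_mean0 b1 b2 b3 : \int[P]_w lin b1 b2 b3 w = 0.
Proof.
have I1 := all_moments_integrable (all_momentsZ b1 a1).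
have I2 := all_moments_integrable (all_momentsZ b2 a2).
have I3 := all_moments_integrable (all_momentsZ b3 a3).
have I12 := all_moments_integrable (all_momentsD (all_momentsZ b1 a1) (all_momentsZ b2 a2)).
rewrite /lin !RintegralD// !RintegralZl//; try exact: all_moments_integrable.
by rewrite m1 m2 m3 !mulr0 !addr0.
Qed.

Let lin_moments b1 b2 b3 k : \int[P]_w lin b1 b2 b3 w ^+ k.+2 =
  k.+1%:R * \int[P]_w lin b1 b2 b3 w ^+ 2 * \int[P]_w lin b1 b2 b3 w ^+ k.
Proof.
have [m [s mgf]] := lin_mgf b1 b2 b3.
have [_ m0 ESS] := mgf_moments (mlin b1 b2 b3) mgf; rewrite lin_mean0 in m0.
(* The recursion at k = 0 identifies the parameter s^2 with the second moment. *)
have s2 : \int[P]_w lin b1 b2 b3 w ^+ 2 = s ^+ 2.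
  by rewrite ESS -m0 Rintegral_expr0 mul0r add0r mul1r mulr1.
by rewrite s2 ESS -m0 mul0r add0r.
Qed.

Let lin_gaussian_moments b1 b2 b3 : gaussian_moments P (lin b1 b2 b3).
Proof.
move=> N; exact: (centered_even_moments (Rintegral_expr0 P _) (lin_moments b1 b2 b3)).
Qed.

Let v1 := \int[P]_w X1 w ^+ 2.
Let v2 := \int[P]_w X2 w ^+ 2.
Let v3 := \int[P]_w X3 w ^+ 2.

Let var_gt0 i : 0 < \int[P]_w tnth [tuple X1; X2; X3] i w ^+ 2.
Proof.
have [_ E0 /(_ i)] := gX; rewrite /variance unlock E0 unlock /= => V0.
have aX : all_moments P (tnth [tuple X1; X2; X3] i).
  by case: i {V0} => -[|[|[|//]]] ?; [exact: a1|exact: a2|exact: a3].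
rewrite -lte_fin /Rintegral fineK; last first.
  by apply: integrable_fin_num => //; exact: aX.2.
apply: (lt_le_trans V0); rewrite le_eqVlt; apply/orP; left; apply/eqP.
apply: eq_integral => w _; congr EFin; set Y := tnth _ i.
by rewrite -[LHS]/((Y w - 0) * (Y w - 0)) subr0 expr2.
Qed.

Let v1_gt0 : 0 < v1. Proof. exact: (var_gt0 ord0). Qed.
Let v2_gt0 : 0 < v2. Proof. exact: (var_gt0 (lift ord0 ord0)). Qed.
Let v3_gt0 : 0 < v3. Proof. exact: (var_gt0 (lift ord0 (lift ord0 ord0))). Qed.

Let uncorrelated := [/\ \int[P]_w (X1 w * X2 w) = 0, \int[P]_w (X1 w * X3 w) = 0 &
  \int[P]_w (X2 w * X3 w) = 0].

(** Without correlations the variance of the combination is the sum of the t_i^2 v_i, so the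
    exponential splits; the sine part has mean 0. *)
Lemma Rintegral_cos_lin t1 t2 t3 th : uncorrelated ->
  \int[P]_w cos (t1 * X1 w + t2 * X2 w + t3 * X3 w - th) =
  cos th * expR (- (t1 ^+ 2 * v1) / 2) * expR (- (t2 ^+ 2 * v2) / 2) * expR (- (t3 ^+ 2 * v3) / 2).
Proof.
move=> [c12 c13 c23].
have mY := mlin t1 t2 t3.
have Ic : P.-integrable [set: T] (EFin \o (fun w => cos (lin t1 t2 t3 w))).
  apply: (@bounded_integrable _ T R P _ 1); last by move=> w; exact: cos_max.
  by apply: measurableT_comp => //; exact: continuous_measurable_fun (@continuous_cos R).
have Is : P.-integrable [set: T] (EFin \o (fun w => sin (lin t1 t2 t3 w))).
  apply: (@bounded_integrable _ T R P _ 1); last by move=> w; exact: sin_max.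
  by apply: measurableT_comp => //; exact: continuous_measurable_fun (@continuous_sin R).
have Ic' := integrableZr measurableT (cos th) Ic.
have Is' := integrableZr measurableT (sin th) Is.
transitivity (\int[P]_w (cos (lin t1 t2 t3 w) * cos th + sin (lin t1 t2 t3 w) * sin th)).
  by apply: eq_Rintegral => w _; rewrite cosB.
rewrite RintegralD// !RintegralZr//.
rewrite (Rintegral_sin (lin_exp_moments t1 t2 t3) (lin_mean0 t1 t2 t3) (lin_moments t1 t2 t3)).
rewrite (Rintegral_cos (lin_exp_moments t1 t2 t3) (lin_moments t1 t2 t3)).
rewrite mul0r addr0 (Rintegral_sqr_comb a1 a2 a3) c12 c13 c23 -/v1 -/v2 -/v3.
rewrite mulrC -!mulrA -!expRD; congr (_ * expR _).
by field.
Qed.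

Let cos_mean (v t c : R) := cos c * expR (- (t ^+ 2 * v) / 2).

Let mcos (Y : T -> R) t c : measurable_fun [set: T] Y ->
  measurable_fun [set: T] (fun w => cos (t * Y w - c)).
Proof.
move=> mY; apply: measurableT_comp; first exact: continuous_measurable_fun (@continuous_cos R).
by apply: measurable_funB => //; exact: measurable_funM.
Qed.

(** A product of three cosines is the mean of four cosines of signed sums, one sign being fixed
    since cosine is even. Signs do not affect the variances, so the same identity, read backwards in
    [c1], [c2], [c3], reassembles the product. *)
Let Rintegral_cos3 t1 t2 t3 c1 c2 c3 : uncorrelated ->
  \int[P]_w (cos (t1 * X1 w - c1) * (cos (t2 * X2 w - c2) * cos (t3 * X3 w - c3))) =
  cos_mean v1 t1 c1 * (cos_mean v2 t2 c2 * cos_mean v3 t3 c3).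
Proof.
move=> unc.
pose g s2 s3 w := cos (t1 * X1 w + s2 * t2 * X2 w + s3 * t3 * X3 w - (c1 + s2 * c2 + s3 * c3)).
have Ig s2 s3 : P.-integrable [set: T] (EFin \o g s2 s3).
  apply: (@bounded_integrable _ T R P _ 1); last by move=> w; exact: cos_max.
  apply: measurableT_comp; first exact: continuous_measurable_fun (@continuous_cos R).
  by apply: measurable_funB => //; exact: mlin.
have gE s2 s3 : s2 ^+ 2 = 1 -> s3 ^+ 2 = 1 -> \int[P]_w g s2 s3 w =
    cos (c1 + s2 * c2 + s3 * c3) * expR (- (t1 ^+ 2 * v1) / 2) * expR (- (t2 ^+ 2 * v2) / 2)
    * expR (- (t3 ^+ 2 * v3) / 2).
  by move=> s2E s3E; rewrite /g Rintegral_cos_lin// !exprMn s2E s3E !mul1r.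
have prod_cos (x y z : R) : cos x * (cos y * cos z) = 4^-1 *
    (cos (x + 1 * y + 1 * z) + cos (x + 1 * y + -1 * z) + cos (x + -1 * y + 1 * z)
      + cos (x + -1 * y + -1 * z)).
  by rewrite !mul1r !mulN1r !cosD !sinD !cosN !sinN; field.
transitivity (\int[P]_w (4^-1 * (g 1 1 w + g 1 (-1) w + g (-1) 1 w + g (-1) (-1) w))).
  apply: eq_Rintegral => w _; rewrite prod_cos /g.
  by congr (_ * (cos _ + cos _ + cos _ + cos _)); ring.
have J2 := integrableD measurableT (Ig 1 1) (Ig 1 (-1)).
have J3 := integrableD measurableT J2 (Ig (-1) 1).
have J4 := integrableD measurableT J3 (Ig (-1) (-1)).
rewrite (RintegralZl _ measurableT J4) (RintegralD measurableT J3 (Ig _ _)).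
rewrite (RintegralD measurableT J2 (Ig _ _)) (RintegralD measurableT (Ig _ _) (Ig _ _)).
rewrite !gE ?expr1n ?sqrrN ?expr1n// /cos_mean.
rewrite -!mulrDl !mulrA -prod_cos.
by ring.
Qed.

Let cos_mean0 v : cos_mean v 0 0 = 1.
Proof. by rewrite /cos_mean cos0 expr0n/= mul0r oppr0 mul0r expR0 mulr1. Qed.

Let Ecos1 t c : uncorrelated -> \int[P]_w cos (t * X1 w - c) = cos_mean v1 t c.
Proof.
move=> unc; have := Rintegral_cos3 t 0 0 c 0 0 unc; rewrite !cos_mean0 !mulr1 => <-.
by apply: eq_Rintegral => w _; rewrite !mul0r !subr0 !cos0 !mulr1.
Qed.

Let Ecos2 t c : uncorrelated -> \int[P]_w cos (t * X2 w - c) = cos_mean v2 t c.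
Proof.
move=> unc; have := Rintegral_cos3 0 t 0 0 c 0 unc; rewrite !cos_mean0 mulr1 mul1r => <-.
by apply: eq_Rintegral => w _; rewrite !mul0r !subr0 !cos0 mulr1 mul1r.
Qed.

Let Ecos3 t c : uncorrelated -> \int[P]_w cos (t * X3 w - c) = cos_mean v3 t c.
Proof.
move=> unc; have := Rintegral_cos3 0 0 t 0 0 c unc; rewrite !cos_mean0 !mul1r => <-.
by apply: eq_Rintegral => w _; rewrite !mul0r !subr0 !cos0 !mul1r.
Qed.

Let Ecos23 t2 c2 t3 c3 : uncorrelated ->
  \int[P]_w (cos (t2 * X2 w - c2) * cos (t3 * X3 w - c3)) = cos_mean v2 t2 c2 * cos_mean v3 t3 c3.
Proof.
move=> unc; have := Rintegral_cos3 0 t2 t3 0 c2 c3 unc; rewrite cos_mean0 mul1r => <-.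
by apply: eq_Rintegral => w _; rewrite mul0r subr0 cos0 mul1r.
Qed.

(** Cosines are exchanged for indicators one variable at a time; at each stage the other two factors
    form the bounded weight of [Rintegral_indic_mul_factor]. *)
Lemma uncorrelated_indic (B1 B2 B3 : set R) : uncorrelated ->
  measurable B1 -> measurable B2 -> measurable B3 ->
  \int[P]_w (\1_B3 (X3 w) * (\1_B2 (X2 w) * \1_B1 (X1 w))) =
  \int[P]_w \1_B3 (X3 w) * (\int[P]_w \1_B2 (X2 w) * \int[P]_w \1_B1 (X1 w)).
Proof.
move=> unc mB1 mB2 mB3.
have mind (Y : {RV P >-> R}) B : measurable B -> measurable_fun [set: T] (fun w => \1_B (Y w) : R).
  by move=> mB; apply: measurableT_comp => //; exact: measurable_indic.
have ind1 (B : set R) x : `|\1_B x : R| <= 1.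
  by rewrite indicE; case: (_ \in _); rewrite ?normr1 ?normr0.
have mul_le1 (x y : R) : `|x| <= 1 -> `|y| <= 1 -> `|x * y| <= 1.
  by move=> ? ?; rewrite normrM -[leRHS]mul1r ler_pM.
have step1 t2 c2 t3 c3 : \int[P]_w (\1_B1 (X1 w) * (cos (t2 * X2 w - c2) * cos (t3 * X3 w - c3)))
    = \int[P]_w \1_B1 (X1 w) * (cos_mean v2 t2 c2 * cos_mean v3 t3 c3).
  apply: (@Rintegral_indic_mul_factor _ T R P X1 _ 1 _ (cos_mean v1)) => //.
  - by apply: measurable_funM; exact: mcos.
  - by move=> w; apply: mul_le1; exact: cos_max.
  - by move=> t c; exact: Ecos1.
  - by move=> t c; exact: Rintegral_cos3.
have step2 t3 c3 : \int[P]_w (\1_B2 (X2 w) * (\1_B1 (X1 w) * cos (t3 * X3 w - c3)))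
    = \int[P]_w \1_B2 (X2 w) * (\int[P]_w \1_B1 (X1 w) * cos_mean v3 t3 c3).
  apply: (@Rintegral_indic_mul_factor _ T R P X2 _ 1 _ (cos_mean v2)) => //.
  - by apply: measurable_funM; [exact: mind|exact: mcos].
  - by move=> w; apply: mul_le1 => //; exact: cos_max.
  - by move=> t c; exact: Ecos2.
  - move=> t c; rewrite mulrCA -step1; apply: eq_Rintegral => w _; rewrite mulrCA//.
apply: (@Rintegral_indic_mul_factor _ T R P X3 _ 1 _ (cos_mean v3)) => //.
- by apply: measurable_funM; exact: mind.
- by move=> w; exact: mul_le1.
- by move=> t c; exact: Ecos3.
- move=> t c; rewrite mulrC -mulrA -step2; apply: eq_Rintegral => w _.
  by rewrite mulrC -mulrA.
Qed.

Let Rintegral_indic_preimage (Y : {RV P >-> R}) (B : set R) : measurable B ->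
  (\int[P]_w \1_B (Y w))%:E = P (Y @^-1` B).
Proof.
move=> mB; have mYB : measurable (Y @^-1` B).
  by rewrite -[X in measurable X]setTI; exact: measurable_funP.
rewrite /Rintegral -[X in fine X]/(\int[P]_w (\1_(Y @^-1` B) w)%:E)%E integral_indic// setIT.
by rewrite fineK// fin_num_measure.
Qed.

Lemma uncorrelated_independent : uncorrelated -> independent_RVs [tuple X1; X2; X3].
Proof.
move=> unc B mB.
set B1 := B ord0; set B2 := B (lift ord0 ord0); set B3 := B (lift ord0 (lift ord0 ord0)).
have mX (Y : {RV P >-> R}) C : measurable C -> measurable (Y @^-1` C).
  by move=> mC; rewrite -[X in measurable X]setTI; exact: measurable_funP.
have -> : [set w | forall i, B i (tnth [tuple X1; X2; X3] i w)] =
    X3 @^-1` B3 `&` (X2 @^-1` B2 `&` X1 @^-1` B1).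
  apply/seteqP; split=> w /=.
    move=> H; split; first exact: (H (lift ord0 (lift ord0 ord0))).
    by split; [exact: (H (lift ord0 ord0))|exact: (H ord0)].
  move=> [b3 [b2 b1]] i.
  have [->|[->|->]] : i = ord0 \/ (i = lift ord0 ord0 \/ i = lift ord0 (lift ord0 ord0)).
    case: i => -[|[|[|//]]] lti; [by left; apply: val_inj|right; left|right; right].
      exact: val_inj.
    exact: val_inj.
  - exact: b1.
  - exact: b2.
  - exact: b3.
rewrite !big_ord_recl big_ord0 mule1 -/B1 -/B2 -/B3.
set S := X3 @^-1` B3 `&` _.
have mS : measurable S by do 2 (apply: measurableI; first exact: mX (mB _)); exact: mX (mB _).
have -> : P S = (\int[P]_w (\1_B3 (X3 w) * (\1_B2 (X2 w) * \1_B1 (X1 w))))%:E.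
  have -> : P S = (\int[P]_w \1_S w)%:E.
    by rewrite /Rintegral integral_indic// setIT fineK// fin_num_measure.
  by congr EFin; apply: eq_Rintegral => w _; rewrite /S !indicI.
rewrite (uncorrelated_indic unc (mB _) (mB _) (mB _)) !EFinM.
rewrite !Rintegral_indic_preimage; try exact: mB.
by rewrite muleC -muleA muleCA.
Qed.

Let lin12 t : gaussian_moments P (fun w => X2 w + t * X1 w).
Proof.
rewrite (_ : (fun w => _) = lin t 1 0); first exact: lin_gaussian_moments.
by apply/funext => w; rewrite /lin; ring.
Qed.

Let lin13 t : gaussian_moments P (fun w => X3 w + t * X1 w).
Proof.
rewrite (_ : (fun w => _) = lin t 0 1); first exact: lin_gaussian_moments.
by apply/funext => w; rewrite /lin; ring.
Qed.

Let lin23 t : gaussian_moments P (fun w => X3 w + t * X2 w).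
Proof.
rewrite (_ : (fun w => _) = lin 0 t 1); first exact: lin_gaussian_moments.
by apply/funext => w; rewrite /lin; ring.
Qed.

(** The Gaussian formula E[X^2 Y^2] = E[X^2] E[Y^2] + 2 E[XY]^2 meets the product rule, which leaves
    E[XY]^2 = 0. Squares supply the nonnegative functions that [integral_mul_independent] asks
    for. *)
Lemma pair_uncorrelated (X Y : {RV P >-> R}) : all_moments P X -> all_moments P Y ->
  (forall t, gaussian_moments P (fun w => Y w + t * X w)) ->
  (forall A B, measurable A -> measurable B ->
    P (X @^-1` A `&` Y @^-1` B) = (P (X @^-1` A) * P (Y @^-1` B))%E) ->
  \int[P]_w (X w * Y w) = 0.
Proof.
move=> aX aY gYX indep.
have mom := Rintegral_sqr_mul_even 0 aX aY gYX.
have msqr : measurable_fun [set: R] (fun x : R => x ^+ 2) by exact: measurable_funX.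
have := integral_mul_independent indep msqr msqr (fun x => sqr_ge0 x) (fun x => sqr_ge0 x).
move=> /(congr1 fine); rewrite fineM; last 2 first.
- by apply: integrable_fin_num => //; exact: aX.2.
- by apply: integrable_fin_num => //; exact: aY.2.
move=> prodE; move: mom; rewrite !muln0 !muln1 Rintegral_expr0 fact0.
rewrite -[\int[P]_w (X w ^+ 2 * Y w ^+ 2)]/(fine _) prodE => mom.
apply/eqP; rewrite -sqrf_eq0; apply/eqP; move: mom.
by rewrite divr1 mulr1 mulrA -[LHS]addr0 => /addrI <-.
Qed.

Lemma independent_uncorrelated : independent_RVs [tuple X1; X2; X3] -> uncorrelated.
Proof.
move=> indep.
have pair3 (A1 A2 A3 : set R) : measurable A1 -> measurable A2 -> measurable A3 ->
    P (X1 @^-1` A1 `&` X2 @^-1` A2 `&` X3 @^-1` A3) =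
    (P (X1 @^-1` A1) * P (X2 @^-1` A2) * P (X3 @^-1` A3))%E.
  move=> mA1 mA2 mA3.
  have := indep (fun i => nth setT [:: A1; A2; A3] i); rewrite !big_ord_recl big_ord0 mule1 muleA.
  move=> <-; last by case=> -[|[|[|//]]].
  congr (P _); apply/seteqP; split=> w /=.
    by move=> [[h1 h2] h3] -[[|[|[|//]]]] ?.
  move=> H; split; last exact: (H (lift ord0 (lift ord0 ord0))).
  by split; [exact: (H ord0)|exact: (H (lift ord0 ord0))].
have PT (Y : {RV P >-> R}) : P (Y @^-1` setT) = 1%E by rewrite preimage_setT probability_setT.
split.
- apply: pair_uncorrelated => // A B mA mB.
  by have := pair3 A B setT mA mB measurableT; rewrite PT mule1 preimage_setT setIT.
- apply: pair_uncorrelated => // A B mA mB.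
  by have := pair3 A setT B mA measurableT mB; rewrite PT mule1 preimage_setT setIT.
- apply: pair_uncorrelated => // A B mA mB.
  by have := pair3 setT A B measurableT mA mB; rewrite PT mul1e preimage_setT setTI.
Qed.

Lemma gaussian_product_inequality m n :
  let lhs := 'E_P[fun w => (X1 w ^+ 2 * X2 w ^+ (2 * m.+1) * X3 w ^+ (2 * n.+1))%R]%E in
  let rhs := ('E_P[fun w => (X1 w ^+ 2)%R] * 'E_P[fun w => (X2 w ^+ (2 * m.+1))%R]
              * 'E_P[fun w => (X3 w ^+ (2 * n.+1))%R])%E in
  (rhs <= lhs)%E /\ (lhs = rhs <-> independent_RVs [tuple X1; X2; X3]).
Proof.
have EP f : all_moments P f -> 'E_P[f]%E = (\int[P]_w f w)%:E.
  move=> af; rewrite unlock /Rintegral fineK//.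
  by apply: integrable_fin_num => //; exact: all_moments_integrable.
have ax1 := all_momentsX 2 a1; have ax2 := all_momentsX (2 * m.+1) a2.
have ax3 := all_momentsX (2 * n.+1) a3.
rewrite /= (EP _ (all_momentsM (all_momentsM ax1 ax2) ax3)) (EP _ ax1) (EP _ ax2) (EP _ ax3).
rewrite -!EFinM lee_fin.
have g123 s t : gaussian_moments P (fun w => X2 w + t * X3 w + s * X1 w).
  rewrite (_ : (fun w => _) = lin s 1 t); first exact: lin_gaussian_moments.
  by apply/funext => w; rewrite /lin; ring.
have [le_mom eq_mom] := gaussian_moment_inequality a1 a2 a3 g123 v1_gt0 v2_gt0 v3_gt0 m n.
split=> //; split=> [e|/independent_uncorrelated unc].
  by apply: uncorrelated_independent; apply: eq_mom.1; exact: EFin_inj e.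
by congr EFin; exact: eq_mom.2 unc.
Qed.

End centered_gaussian_vector.

Theorem proposition3p3 (R : realType)
    (c_gt0 : forall m2 m3 : nat, (2 <= m2)%N -> (1 <= m3)%N ->
       forall p : nat, (3 <= p <= 2 * m2 - 1)%N -> 0 < coef_c R m2 m3 p)
    (m2 m3 : nat) (m2_ge1 : (1 <= m2)%N) (m3_ge1 : (1 <= m3)%N)
    (d : measure_display) (T : measurableType d) (P : probability T R)
    (X1 X2 X3 : {RV P >-> R})
    (X_gauss : centered_gaussian_vector [tuple X1; X2; X3]) :
  let lhs := 'E_P[fun w => (X1 w ^+ 2 * X2 w ^+ (2 * m2) * X3 w ^+ (2 * m3))%R]%E in
  let rhs := ('E_P[fun w => (X1 w ^+ 2)%R] * 'E_P[fun w => (X2 w ^+ (2 * m2))%R]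
              * 'E_P[fun w => (X3 w ^+ (2 * m3))%R])%E in
  (rhs <= lhs)%E /\ (lhs = rhs <-> independent_RVs [tuple X1; X2; X3]).
Proof.
case: m2 m2_ge1 => // m _; case: m3 m3_ge1 => // n _.
exact: gaussian_product_inequality.
Qed.
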